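(* Let $(p_n)_{n}$ be a sequence in $(0,1)$ such that, for some fixed $\xi>1$, $\frac{(\log n)^{6\xi}}{np_n}\to 0$ as $n\to\infty$, and such that $p_n\le \overline{p}$ for all $n$, for some fixed $\overline{p}\in(0,1)$. For each $n$ let $G_n$ be an Erdős–Rényi random graph $\mathcal{G}(n,p_n)$ on $V_n=\{1,\dots,n\}$, let $j$ be a fixed vertex, and let $H_j=H_j^{(n)}=\sum_{i\in V_n}\pi_i H_{ij}$ be the mean target hitting time of $j$ for the simple random walk on $G_n$. Then $$\sqrt{\frac{p_n}{n(1-p_n)}}\,\bigl(H_j-n\bigr)\longrightarrow \mathcal{N}(0,1)\quad\text{in distribution as } n\to\infty,$$ where $\mathcal{N}(0,1)$ is the standard normal distribution.
   Context: $\mathcal{G}(n,p)$: the random simple undirected graph $G_n=(V_n,E_n)$ on $V_n=\{1,\dots,n\}$ in which each pair $\{i,k\}$ with $i\ne k$ is an edge with probability $p$, independently of all other pairs. Let $d_i$ be the degree of $i$. The simple random walk on $G_n$ is the discrete-time Markov chain that moves from $i$ to each neighbor of $i$ with probability $1/d_i$; its invariant distribution is $\pi_i=\frac{d_i}{\sum_{k\in V_n}d_k}=\frac{d_i}{2|E_n|}$. $H_{ij}$ is the expected time (in the random walk measure, for the given realization of the graph) the walk started at $i$ needs to reach $j$, with $H_{jj}=0$. Thus $H_j$ is a random variable as a function of the random graph. Connectivity of the graph is tacitly assumed: under the hypotheses on $p_n$, $G_n$ is connected with probability tending to $1$, and $H_j$ may be given an arbitrary real value on the event that $G_n$ is not connected.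 *)

(* Defs.v *)
From HB Require Import structures.
From mathcomp Require Import all_boot all_order all_algebra.
From mathcomp Require Import all_classical all_reals all_analysis.

Set Implicit Arguments.
Unset Strict Implicit.
Unset Printing Implicit Defensive.

Import Order.TTheory GRing.Theory Num.Theory.
Import numFieldNormedType.Exports.

Local Open Scope classical_set_scope.
Local Open Scope ring_scope.

Record sgraph (V : finType) := SGraph {
  adj :> rel V;
  adj_sym : symmetric adj;
  adj_irr : irreflexive adj }.

Section SimpleRandomWalk.
Context {R : realType} {V : finType}.
Implicit Types (G : sgraph V) (i j k : V).

Definition degree G i : nat := #|[set k | G i k]|.

Definition connected_graph G : bool := [forall i, forall k, connect G i k].

Definition step_prob G i k : R := (G i k)%:R / (degree G i)%:R.

Definition invariant_distr G i : R :=
  (degree G i)%:R / (\sum_(k : V) degree G k)%N%:R.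

(* P_i(X_1 = s_1, ..., X_t = s_t) for the walk X started at X_0 = i. *)
Fixpoint walk_prob G i (s : seq V) : R :=
  if s is k :: s' then step_prob G i k * walk_prob G k s' else 1.

(* P_i(T_j = t) for T_j = inf {t >= 0 | X_t = j}: the trajectories
   X_0 = i, X_1, ..., X_t whose first visit to j occurs at time t. *)
Definition hitting_time_prob G i j (t : nat) : R :=
  \sum_(s : t.-tuple V | index j (i :: s) == t) walk_prob G i s.

(* E_i(T_j). The last summand is +oo * P_i(T_j = +oo); the convention
   +oo * 0 = 0 makes it vanish when j is reached almost surely. *)
Definition hitting_time G i j : \bar R :=
  (\sum_(0 <= t <oo) (t%:R * hitting_time_prob G i j t)%:E
   + +oo * (1 - \sum_(0 <= t <oo) (hitting_time_prob G i j t)%:E))%E.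

Definition mean_target_hitting_time G j : \bar R :=
  (\sum_(i : V) (invariant_distr G i)%:E * hitting_time G i j)%E.

(* h0 supplies the irrelevant real value on graphs that are not connected. *)
Definition target_hitting_time_or (h0 : sgraph V -> R) G j : R :=
  if connected_graph G then fine (mean_target_hitting_time G j) else h0 G.

End SimpleRandomWalk.

Section RandomGraph.
Context {d : measure_display} {T : measurableType d} {R : realType}.
Variable P : probability T R.

Definition mutually_independent (I : finType) (D : {pred I}) (A : I -> set T) :=
  forall S : {set I}, {subset S <= D} ->
    P (\bigcap_(e in [set` S]) A e) = (\prod_(e in S) P (A e))%E.

Definition edge_event (n : nat) (G : T -> sgraph 'I_n) (e : 'I_n * 'I_n) :
  set T := [set w | G w e.1 e.2].

(* The unordered pair {i, k}, i != k, is encoded as (i, k) with i < k. *)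
Definition erdos_renyi (n : nat) (G : T -> sgraph 'I_n) (p : R) :=
  let pairs := [pred e : 'I_n * 'I_n | (e.1 < e.2)%N] in
  [/\ forall e, e \in pairs -> measurable (edge_event G e),
      forall e, e \in pairs -> P (edge_event G e) = p%:E
    & mutually_independent pairs (edge_event G)].

End RandomGraph.

(* Convergence of the distribution functions at every continuity point of the
   distribution function of mu. *)
Definition cvg_in_distribution (R : realType) (d : nat -> measure_display)
    (T : forall n, measurableType (d n)) (P : forall n, probability (T n) R)
    (X : forall n, T n -> R) (mu : probability (measurableTypeR R) R) :=
  forall x : R,
    {for x, continuous (fun y : R => mu `]-oo, y]%classic)} ->
    P n [set w | X n w <= x] @[n --> \oo] --> mu `]-oo, x]%classic.

(* Main.v *)
Require Import Defs.
From HB Require Import structures.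
From mathcomp Require Import all_boot all_order all_algebra.
From mathcomp Require Import all_classical all_reals all_analysis.
From mathcomp Require Import measurable_realfun.
From mathcomp Require Import ring lra.

Set Implicit Arguments.
Unset Strict Implicit.
Unset Printing Implicit Defensive.

Import Order.TTheory GRing.Theory Num.Theory.
Import numFieldNormedType.Exports.

Local Open Scope classical_set_scope.
Local Open Scope ring_scope.

(* Write vol for the sum of all degrees, h for the function i |-> H_{ij} and E
   for the Dirichlet energy, and put g = h + (vol / d_j) delta_j.  Since the graph
   Laplacian of h is d - vol delta_j, one finds
   H_j = vol / d_j - 2 + E(g) / (2 vol), and a Poincare inequality bounds the last
   term.  On an Erdos-Renyi graph with n p >> log n, Chernoff bounds over all
   vertex sets give edge expansion, hence (Cheeger) a Poincare constant
   O(1 / (n p)), so that H_j = vol / d_j + O(1 / p).  As vol fluctuates much less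
   than n d_j, the rescaled H_j - n is
   - (d_j - (n - 1) p) / sqrt ((n - 1) p (1 - p)) up to an error tending to 0 in
   probability.  The central limit theorem for this binomial variable follows from
   Stein's method with compactly supported test functions of Gaussian mean 0, for
   which the solution of Stein's equation is again compactly supported. *)

(** * Walks, hitting times and the Dirichlet energy *)

(** Cheeger's inequality usually squares the loss, but here the edge expansion and the maximal
    degree are both of order n p, so [D / alpha ^ 2] still has the right order 1 / (n p) and crude
    Chernoff constants suffice. The resulting error O(1 / p) in H_j becomes O(1 / sqrt (n p (1 -
    p))) after scaling. Hitting times are defined by sums over trajectories with values in the
    extended reals. The same Poincare inequality shows that these sums are finite and that the
    target is reached almost surely, so that h is a genuine real solution of the Laplace equation.
    For a test function of compact support and Gaussian mean 0, the derivative of Stein's solution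
    is continuous with compact support, hence uniformly continuous. This replaces the usual explicit
    bounds on that solution. A test function of nonzero mean is recentred by subtracting a multiple
    of a wide bump, whose expectation is close to 1 under both laws. Probability spaces enter only
    through the law of the edge set, after which every probability is a finite weighted sum over
    sets of pairs. *)

Lemma cvgn_unique {R : realType} (u : nat -> R) (a b : R) :
  u @ \oo --> a -> u @ \oo --> b -> a = b.
Proof. by move=> /cvg_lim <- // /cvg_lim <-. Qed.

Section Laplacian.
Context {R : realType} {V : finType} (G : sgraph V).
Implicit Types (f g h u : V -> R) (i k : V).

Definition laplacian f i : R := \sum_k (G i k)%:R * (f i - f k).

Definition energy f : R := \sum_i \sum_k (G i k)%:R * (f i - f k) ^+ 2.

Definition volume : nat := \sum_(k : V) degree G k.

(** The centre [m] is left free: the mean would minimise the left-hand side, while the Cheeger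
    argument produces a median. The energy counts each edge twice, once per orientation. *)
Definition poincare (K : R) :=
  forall f, exists m, \sum_i (f i - m) ^+ 2 <= K * energy f.

Lemma degreeE i : (degree G i)%:R = \sum_k (G i k)%:R :> R.
Proof.
rewrite /degree -sum1_card natr_sum big_mkcond /=.
apply: eq_bigr => k _; have -> : (k \in [set k | G i k]) = G i k.
  by apply/idP/idP => [/set_mem|/mem_set].
by case: (G i k).
Qed.

Lemma volumeE : volume%:R = \sum_k (degree G k)%:R :> R.
Proof. by rewrite natr_sum. Qed.

Lemma laplacianE f i :
  laplacian f i = (degree G i)%:R * f i - \sum_k (G i k)%:R * f k.
Proof.
rewrite degreeE mulr_suml -sumrB; apply: eq_bigr => k _.
by rewrite mulrBr.
Qed.

Lemma laplacian_green f g :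
  (\sum_i f i * laplacian g i) *+ 2 =
  \sum_i \sum_k (G i k)%:R * ((f i - f k) * (g i - g k)).
Proof.
have E : \sum_i f i * laplacian g i =
    \sum_i \sum_k (G i k)%:R * (f i * (g i - g k)).
  apply: eq_bigr => i _; rewrite /laplacian mulr_sumr.
  by apply: eq_bigr => k _; rewrite mulrCA.
have E' : \sum_i f i * laplacian g i =
    \sum_i \sum_k (G i k)%:R * (f k * (g k - g i)).
  rewrite E exchange_big /=; apply: eq_bigr => i _; apply: eq_bigr => k _.
  by rewrite adj_sym.
rewrite mulr2n {1}E E' -big_split /=; apply: eq_bigr => i _.
rewrite -big_split /=; apply: eq_bigr => k _; ring.
Qed.

Lemma energy_green f : energy f = (\sum_i f i * laplacian f i) *+ 2.
Proof.
by rewrite laplacian_green; apply: eq_bigr => i _; apply: eq_bigr => k _; rewrite expr2.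
Qed.

Lemma sum_laplacian f : \sum_i laplacian f i = 0.
Proof.
have := laplacian_green (fun=> 1) f.
under eq_bigr do rewrite mul1r.
under [RHS]eq_bigr do under eq_bigr do rewrite subrr mul0r mulr0.
under [RHS]eq_bigr do rewrite big1_eq.
rewrite big1_eq => /eqP; rewrite mulrn_eq0 /= => /eqP; exact.
Qed.

Lemma energy_ge0 f : 0 <= energy f.
Proof.
by apply: sumr_ge0 => i _; apply: sumr_ge0 => k _; rewrite mulr_ge0 ?ler0n ?sqr_ge0.
Qed.

Lemma poincare_dist K f i k : 0 <= K -> poincare K ->
  (f i - f k) ^+ 2 <= 4 * K * energy f.
Proof.
move=> K0 /(_ f)[m Hm].
have B l : (f l - m) ^+ 2 <= K * energy f.
  apply: le_trans Hm; rewrite (bigD1 l) //= lerDl.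
  by apply: sumr_ge0 => *; exact: sqr_ge0.
have := B i; have := B k; have := sqr_ge0 (f i + f k - 2 * m).
nra.
Qed.

Lemma energy0_cst K f i k : 0 <= K -> poincare K -> energy f = 0 -> f i = f k.
Proof.
move=> K0 HK E0; have := poincare_dist f i k K0 HK; rewrite E0 mulr0 => H.
by apply/eqP; rewrite -subr_eq0 -sqrf_eq0 eq_le H sqr_ge0.
Qed.

End Laplacian.

Section HittingTime.
Context {R : realType} {V : finType} (G : sgraph V) (j : V) (K : R).
Hypothesis K_gt0 : 0 < K.
Hypothesis deg_gt0 : forall i, (0 < degree G i)%N.
Hypothesis HK : poincare G K.
Implicit Types (u : V -> R) (i k : V).

Local Notation q := (hitting_time_prob (R := R) G ^~ j).

Let degR_gt0 i : 0 < (degree G i)%:R :> R. Proof. by rewrite ltr0n. Qed.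

Lemma degree_step_prob i u :
  (degree G i)%:R * (\sum_k step_prob G i k * u k) = \sum_k (G i k)%:R * u k.
Proof.
rewrite mulr_sumr; apply: eq_bigr => k _; rewrite mulrA; congr (_ * _).
by rewrite /step_prob mulrC divfK // gt_eqF.
Qed.

Lemma step_prob_ge0 i k : 0 <= step_prob G i k :> R.
Proof. by rewrite divr_ge0 ?ler0n. Qed.

Lemma sum_step_prob i : \sum_k step_prob G i k = 1 :> R.
Proof. by rewrite -mulr_suml -degreeE divff // gt_eqF. Qed.

Lemma walk_prob_ge0 i s : 0 <= walk_prob G i s :> R.
Proof. by elim: s i => //= k s IH i; rewrite mulr_ge0 ?step_prob_ge0. Qed.

Lemma hitting_time_prob_ge0 i t : 0 <= q i t.
Proof. by apply: sumr_ge0 => s _; exact: walk_prob_ge0. Qed.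

Lemma hitting_time_prob0 i : q i 0 = (i == j)%:R.
Proof.
rewrite /hitting_time_prob big_mkcond (bigD1 [tuple]) //= big1 => [|s]; last first.
  by rewrite (tuple0 s) => /eqP; case.
by rewrite addr0; case: (i == j).
Qed.

(** First-step decomposition: a trajectory of length t + 1 is split into its first vertex and the
    rest. The factor [(i != j)] appears because a walk started at [j] has already arrived at time
    0. *)
Lemma hitting_time_probS i t :
  q i t.+1 = (i != j)%:R * \sum_k step_prob G i k * q k t.
Proof.
rewrite /hitting_time_prob.
have [->|ij] := eqVneq i j.
  rewrite mul0r big1 // => s; by rewrite /= eqxx.
rewrite mul1r; under [RHS]eq_bigr do rewrite mulr_sumr.
rewrite pair_big_dep /=.
rewrite (reindex (fun p : V * t.-tuple V => cons_tuple p.1 p.2)) /=; last first.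
  exists (fun s : t.+1.-tuple V => (thead s, behead_tuple s)) => [[k s] _|s _].
    by rewrite theadE; congr pair; exact: val_inj.
  by rewrite [RHS]tuple_eta; exact: val_inj.
by apply: eq_big => [[k s]|[k s] _] //=; rewrite (negbTE ij) eqSS.
Qed.

(** In terms of the hitting time T of [j], [s N i] is P_i(T < N) and [v N i] is E_i(T; T < N). Both
    are finite sums that increase with [N], so limits can be taken once they are bounded. *)
Let s N i : R := \sum_(0 <= t < N) q i t.
Let v N i : R := \sum_(0 <= t < N) t%:R * q i t.

Let sS N i : i != j -> s N.+1 i = \sum_k step_prob G i k * s N k.
Proof.
move=> ij; rewrite /s big_nat_recl // hitting_time_prob0 (negbTE ij) add0r.
under eq_bigr do rewrite hitting_time_probS ij mul1r.
by rewrite exchange_big /=; apply: eq_bigr => k _; rewrite mulr_sumr.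
Qed.

Let sSj N : s N.+1 j = 1.
Proof.
rewrite /s big_nat_recl // hitting_time_prob0 eqxx big1 ?addr0 // => t _.
by rewrite hitting_time_probS eqxx mul0r.
Qed.

Let vS N i : i != j -> v N.+1 i = \sum_k step_prob G i k * (v N k + s N k).
Proof.
move=> ij; rewrite /v big_nat_recl // mul0r add0r.
under eq_bigr do rewrite hitting_time_probS ij mul1r mulr_sumr.
rewrite exchange_big /=; apply: eq_bigr => k _.
rewrite /s -big_split mulr_sumr /=; apply: eq_bigr => t _.
by rewrite mulrCA -natr1 mulrDl mul1r.
Qed.

Let vj N : v N j = 0.
Proof.
rewrite /v big1 // => -[|t] _; first by rewrite mul0r.
by rewrite hitting_time_probS eqxx mul0r mulr0.
Qed.

Let s_nd i : {homo s ^~ i : m n / (m <= n)%N >-> m <= n}.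
Proof.
apply/nondecreasing_seqP => N; rewrite /s big_nat_recr //= lerDl.
exact: hitting_time_prob_ge0.
Qed.

Let v_nd i : {homo v ^~ i : m n / (m <= n)%N >-> m <= n}.
Proof.
apply/nondecreasing_seqP => N; rewrite /v big_nat_recr //= lerDl mulr_ge0 //.
exact: hitting_time_prob_ge0.
Qed.

Let s_le1 N i : s N i <= 1.
Proof.
elim: N i => [|N IH] i; first by rewrite /s big_nil.
have [->|ij] := eqVneq i j; first by rewrite sSj.
rewrite sS // -(sum_step_prob i); apply: ler_sum => k _.
by rewrite -[leRHS]mulr1 ler_wpM2l ?step_prob_ge0.
Qed.

Let v_ge0 N i : 0 <= v N i.
Proof. by apply: sumr_ge0 => t _; rewrite mulr_ge0 ?hitting_time_prob_ge0. Qed.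

Let bound : R :=
  1 + 64 * K ^+ 2 * #|V|%:R ^+ 2 * \sum_i (degree G i)%:R ^+ 2.

(** Testing the inequality against [u] bounds its energy by a sum linear in [u]; the Poincare
    inequality with [u j = 0] bounds the sum of squares by the energy, and AM-GM absorbs the linear
    term. The bound does not depend on [u], so it holds for all truncations [v N] at once. *)
Lemma subsolution_bound u : (forall i, 0 <= u i) -> u j = 0 ->
    (forall i, i != j -> laplacian G u i <= (degree G i)%:R) ->
  forall i, u i <= bound.
Proof.
move=> u0 uj Hu i.
have n_gt0 : 0 < #|V|%:R :> R by rewrite ltr0n; apply/card_gt0P; exists j.
set n := #|V|%:R in n_gt0 *; set S := \sum_i u i ^+ 2.
have E_le : energy G u <= 2 * \sum_i u i * (degree G i)%:R.
  rewrite energy_green -mulr_natl ler_wpM2l // ler_sum // => k _.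
  have [->|kj] := eqVneq k j; first by rewrite uj !mul0r.
  by rewrite ler_wpM2l // Hu.
have S_le : S <= 4 * K * n * energy G u.
  have -> : 4 * K * n * energy G u = \sum_(k : V) 4 * K * energy G u.
    by rewrite sumr_const -[RHS]mulr_natr -/n; ring.
  apply: ler_sum => k _; have := poincare_dist u k j (ltW K_gt0) HK.
  by rewrite uj subr0.
have AM : \sum_i u i * (degree G i)%:R <=
    S / (16 * K * n) + 4 * K * n * \sum_i (degree G i)%:R ^+ 2.
  rewrite mulr_suml mulr_sumr -big_split /=; apply: ler_sum => k _.
  set d := _%:R; rewrite -subr_ge0.
  have -> : u k ^+ 2 / (16 * K * n) + 4 * K * n * d ^+ 2 - u k * d =
      (u k - 8 * K * n * d) ^+ 2 / (16 * K * n).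
    by field; rewrite !gt_eqF.
  by rewrite divr_ge0 ?sqr_ge0 // !mulr_ge0 ?ltW.
have {}AM : 16 * K * n * (\sum_i u i * (degree G i)%:R) <=
    S + 64 * K ^+ 2 * n ^+ 2 * \sum_i (degree G i)%:R ^+ 2.
  have -> : S + 64 * K ^+ 2 * n ^+ 2 * \sum_i (degree G i)%:R ^+ 2 = 16 * K * n *
      (S / (16 * K * n) + 4 * K * n * \sum_i (degree G i)%:R ^+ 2).
    by field; rewrite !gt_eqF.
  by rewrite ler_pM2l // !mulr_gt0.
have uS : u i ^+ 2 <= S.
  by rewrite /S (bigD1 i) //= lerDl; apply: sumr_ge0 => *; exact: sqr_ge0.
have Kn : 0 <= K * n by rewrite mulr_ge0 ?ltW.
have := ler_wpM2l Kn E_le.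
rewrite /bound -/n; have := sqr_ge0 (u i - 1); have := sqr_ge0 (u i).
move: (\sum_i _) AM => D; move: (\sum_i _) => Q; move: (energy G u) S_le E_le.
move=> E; nra.
Qed.

Let h i : R := limn (v ^~ i).
Let sl i : R := limn (s ^~ i).

Let s_cvg i : s N i @[N --> \oo] --> sl i.
Proof.
apply: nondecreasing_is_cvgn; first exact: s_nd.
by exists 1 => _ [N _ <-]; exact: s_le1.
Qed.

(** Truncation only lowers the first-step equation to an inequality, since [v N] is at most [v N.+1]
    and [s N] at most 1. *)
Let v_laplacian N i : i != j -> laplacian G (v N) i <= (degree G i)%:R.
Proof.
move=> ij; rewrite laplacianE lerBlDr.
have H : v N i <= 1 + \sum_k step_prob G i k * v N k.
  apply: le_trans (v_nd i (leqnSn N)) _; rewrite vS //.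
  under eq_bigr do rewrite mulrDr.
  rewrite big_split /= addrC lerD2r -(sum_step_prob i); apply: ler_sum => k _.
  by rewrite -[leRHS]mulr1 ler_wpM2l ?step_prob_ge0.
by have := ler_wpM2l (ltW (degR_gt0 i)) H; rewrite mulrDr mulr1 degree_step_prob.
Qed.

Let v_cvg i : v N i @[N --> \oo] --> h i.
Proof.
apply: nondecreasing_is_cvgn; first exact: v_nd.
exists bound => _ [N _ <-]; apply: (@subsolution_bound (v N)) => //.
by move=> k; exact: v_laplacian.
Qed.

(** The probability of ever reaching [j] is harmonic off [j]. As a Laplacian sums to 0, it is
    harmonic at [j] too; so its energy vanishes and it is constant, equal to its value 1 at [j]. *)
Let sl_eq1 i : sl i = 1.
Proof.
have slj : sl j = 1.
  apply: (cvgn_unique (@s_cvg j)).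
  by rewrite -cvg_shiftS; under eq_fun do rewrite /= sSj; exact: cvg_cst.
have slS k : k != j -> laplacian G sl k = 0.
  move=> kj; have E : sl k = \sum_l step_prob G k l * sl l.
    apply: (cvgn_unique (@s_cvg k)) => //.
    rewrite -cvg_shiftS; under eq_fun do rewrite /= (sS _ kj).
    apply: cvg_big => [|l _]; first exact: add_continuous.
    by apply: cvgMr; exact: s_cvg.
  by rewrite laplacianE E degree_step_prob subrr.
have slj0 : laplacian G sl j = 0.
  have := sum_laplacian G sl; rewrite (bigD1 j) //= big1 ?addr0 //.
rewrite -slj; apply: (energy0_cst _ _ (ltW K_gt0) HK).
rewrite energy_green big1 ?mul0rn // => k _.
by have [->|kj] := eqVneq k j; rewrite ?slj0 ?slS ?mulr0.
Qed.

Let h_laplacian i : i != j -> laplacian G h i = (degree G i)%:R.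
Proof.
move=> ij; have E : h i = \sum_k step_prob G i k * (h k + 1).
  apply: (cvgn_unique (@v_cvg i)) => //.
  rewrite -cvg_shiftS; under eq_fun do rewrite /= (vS _ ij).
  apply: cvg_big => [|l _]; first exact: add_continuous.
  by apply: cvgMr; apply: cvgD; [exact: v_cvg|rewrite -(sl_eq1 l); exact: s_cvg].
rewrite laplacianE {1}E degree_step_prob.
under eq_bigr do rewrite mulrDr mulr1.
by rewrite big_split /= -degreeE addrAC subrr add0r.
Qed.

Lemma hitting_time_solves : exists h : V -> R,
  [/\ forall i, hitting_time G i j = (h i)%:E, h j = 0 &
      forall i, i != j -> laplacian G h i = (degree G i)%:R].
Proof.
exists h; split => [i||]; last exact: h_laplacian.
- rewrite /hitting_time.
  have -> : (\sum_(0 <= t <oo) (t%:R * q i t)%:E = (h i)%:E)%E.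
    apply/cvg_lim => //; under eq_fun do rewrite sumEFin.
    exact/cvg_EFin/v_cvg/nearW.
  have -> : (\sum_(0 <= t <oo) (q i t)%:E = 1%:E)%E.
    apply/cvg_lim => //; under eq_fun do rewrite sumEFin.
    by apply/cvg_EFin; [exact: nearW|rewrite -(sl_eq1 i); exact: s_cvg].
  (* The term for never reaching [j] is [+oo * 0], which is 0 by convention. *)
  by rewrite subee // mule0 adde0.
- apply: (cvgn_unique (@v_cvg j)) => //.
  by under eq_fun do rewrite /= vj; exact: cvg_cst.
Qed.

(* The test function [h + (vol / d_j) delta_j] turns the mean hitting time into
   [vol / d_j - 2] plus a nonnegative energy, which the Poincare inequality
   bounds. *)
Lemma mean_target_hitting_time_bounds (D : R) :
    (forall i, (degree G i)%:R <= D) ->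
  let c := (volume G)%:R / (degree G j)%:R in
  exists2 H : R, mean_target_hitting_time G j = H%:E &
    c - 2 <= H <= c - 2 + 2 * K * (D + c).
Proof.
move=> HD c; have [hh [hE hj hL]] := hitting_time_solves.
set dg := fun i => (degree G i)%:R : R.
set vol : R := (volume G)%:R in c *.
have volD : vol = dg j + \sum_(i | i != j) (degree G i)%:R.
  by rewrite /vol volumeE (bigD1 j).
have vol_gt0 : 0 < vol.
  by rewrite volD ltr_wpDr ?degR_gt0 ?sumr_ge0.
have cE : c * dg j = vol by rewrite /c divfK // gt_eqF.
have c_gt0 : 0 < c by rewrite divr_gt0.
have hLj : laplacian G hh j = dg j - vol.
  have := sum_laplacian G hh; rewrite (bigD1 j) //=.
  under eq_bigr => i ij do rewrite (hL _ ij).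
  move/eqP; rewrite addr_eq0 => /eqP ->.
  by rewrite volD; ring.
have sumah : \sum_i (G j i)%:R * hh i = vol - dg j.
  by have := hLj; rewrite laplacianE hj mulr0 => H; lra.
(* Since [c * dg j = vol], the added multiple of delta_j replaces the point mass - vol in the
   Laplacian by masses - c on the neighbours of [j]. This brings the squared norm of [rho] down from
   order vol ^ 2 to [vol * (D + c)]. *)
pose g i := hh i + c * (i == j)%:R.
pose rho i := dg i - c * (G i j)%:R.
have gL i : laplacian G g i = rho i.
  have -> : laplacian G g i =
      laplacian G hh i + c * laplacian G (fun k => (k == j)%:R) i.
    rewrite /laplacian mulr_sumr -big_split; apply: eq_bigr => k _.
    by rewrite /g /=; ring.
  rewrite [X in c * X]laplacianE (bigD1 j) //= eqxx mulr1 big1 ?addr0; last first.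
    by move=> k /negPf ->; rewrite mulr0.
  rewrite /rho; have [->|ij] := eqVneq i j.
    by rewrite hLj adj_irr -/(dg j) -{1}cE /=; ring.
  by rewrite (hL _ ij) /= -/(dg i); ring.
have rho0 : \sum_i rho i = 0 by have := sum_laplacian G g; under eq_bigr do rewrite gL.
pose H := \sum_i invariant_distr G i * hh i.
have volH : vol * H = \sum_i dg i * hh i.
  rewrite mulr_sumr; apply: eq_bigr => i _; rewrite /invariant_distr mulrA.
  by congr (_ * _); rewrite mulrC -/(volume G) divfK // gt_eqF.
(* The summand 2 collects two contributions [c * dg j = vol]: one from the sum of [hh] over the
   neighbours of [j], one from [rho] at [j]. *)
have Eg : energy G g = 2 * vol * (H - c + 2).
  rewrite energy_green -mulr_natl -mulrA; congr (_ * _).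
  have -> : \sum_i g i * laplacian G g i =
      \sum_i dg i * hh i - c * (\sum_i (G j i)%:R * hh i) +
      \sum_i c * (i == j)%:R * rho i.
    rewrite mulr_sumr -sumrB -big_split /=; apply: eq_bigr => i _.
    by rewrite gL /g /rho (adj_sym G j i); ring.
  rewrite -volH sumah (bigD1 j) //= big1 => [|i /negPf ->]; last by rewrite mulr0 mul0r.
  rewrite eqxx mulr1 addr0 /rho adj_irr mulr0 subr0.
  by have := cE; move: (dg j) => a <-; ring.
exists H.
  rewrite /mean_target_hitting_time /H -sumEFin; apply: eq_bigr => i _.
  by rewrite hE.
have E0 := energy_ge0 G g; apply/andP; split.
  move: E0; rewrite Eg pmulr_rge0 ?mulr_gt0 //; lra.
have [m Hm] := HK g.
(* As [rho] sums to 0, [g] may be centred. AM-GM is then weighted so that the Poincare inequality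
   turns the part in [g i - m] into half of the energy, which is absorbed. *)
have E_half : energy G g = 2 * \sum_i (g i - m) * rho i.
  rewrite energy_green -mulr_natl; congr (_ * _).
  under [RHS]eq_bigr do rewrite mulrBl.
  rewrite sumrB -mulr_sumr rho0 mulr0 subr0.
  by apply: eq_bigr => i _; rewrite gL.
have E_le : energy G g <= 4 * K * \sum_i rho i ^+ 2.
  have : energy G g <= (\sum_i (g i - m) ^+ 2) / (2 * K) + 2 * K * \sum_i rho i ^+ 2.
    rewrite {1}E_half mulr_suml !mulr_sumr -big_split /=; apply: ler_sum => i _.
    rewrite -subr_ge0; set a := g i - m; set b := rho i.
    have -> : a ^+ 2 / (2 * K) + 2 * K * b ^+ 2 - 2 * (a * b) =
      (a - 2 * K * b) ^+ 2 / (2 * K) by field; rewrite gt_eqF.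
    by rewrite divr_ge0 ?sqr_ge0 ?mulr_ge0 ?ltW.
  have : (\sum_i (g i - m) ^+ 2) / (2 * K) <= energy G g / 2.
    rewrite ler_pdivrMr ?mulr_gt0 //.
    by apply: le_trans Hm _; rewrite le_eqVlt; apply/orP; left; apply/eqP; field.
  lra.
have rho_le : \sum_i rho i ^+ 2 <= vol * (D + c).
  have -> : vol * (D + c) = \sum_i (D * dg i + c ^+ 2 * (G i j)%:R).
    have Ej : \sum_i (G i j)%:R = dg j.
      by rewrite /dg degreeE; apply: eq_bigr => i _; rewrite adj_sym.
    by rewrite big_split /= -!mulr_sumr Ej -volumeE -/vol -cE; ring.
  apply: ler_sum => i _; rewrite /rho sqrrB.
  have a2 : ((G i j)%:R : R) ^+ 2 = (G i j)%:R by case: (G i j); rewrite ?expr1n ?expr0n.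
  rewrite exprMn a2 lerD2r.
  have d0 : 0 <= dg i by exact: ler0n.
  have : 0 <= dg i * (c * (G i j)%:R) by rewrite !mulr_ge0 // ltW.
  have := ler_wpM2r d0 (HD i); rewrite -/(dg i) => H1 H2.
  by rewrite expr2; apply: le_trans H1; rewrite gerBl mulrn_wge0.
have : vol * (H - c + 2) <= vol * (2 * K * (D + c)).
  have := le_trans E_le (ler_wpM2l _ rho_le); rewrite Eg => /(_ _)/wrap[].
    by rewrite mulr_ge0 // ltW.
  lra.
by rewrite ler_pM2l //; lra.
Qed.

End HittingTime.

(** * Expansion implies a Poincare inequality *)

Section Cheeger.
Context {R : realType} {V : finType} (G : sgraph V).
Implicit Types (f phi psi : V -> R) (i k : V) (S : {set V}).

Definition cut S : R :=
  \sum_i \sum_k (G i k)%:R * ((i \in S) && (k \notin S))%:R.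

Variables (alpha D : R).
Hypothesis alpha_gt0 : 0 < alpha.
Hypothesis D_gt0 : 0 < D.
Hypothesis deg_le : forall i, (degree G i)%:R <= D.
Hypothesis expansion : forall S : {set V},
  (0 < #|S|)%N -> (2 * #|S| <= #|V|)%N -> alpha * #|S|%:R <= cut S.

Lemma cutE S : \sum_i \sum_k (G i k)%:R * `|(i \in S)%:R - (k \in S)%:R| = 2 * cut S :> R.
Proof.
have E : cut S = \sum_i \sum_k (G i k)%:R * ((k \in S) && (i \notin S))%:R.
  rewrite /cut exchange_big /=; apply: eq_bigr => i _; apply: eq_bigr => k _.
  by rewrite adj_sym.
rewrite mulr_natl mulr2n {1}E /cut -big_split /=; apply: eq_bigr => i _.
rewrite -big_split /=; apply: eq_bigr => k _; rewrite -mulrDr; congr (_ * _).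
by case: (i \in S); case: (k \in S) => /=;
  rewrite ?subrr ?subr0 ?sub0r ?normrN ?normr0 ?normr1 ?addr0 ?add0r.
Qed.

(* The discrete coarea formula, by peeling off the support of [phi] at the height
   of its smallest positive value. *)
Lemma cut_coarea phi :
    (forall i, 0 <= phi i) -> (2 * #|[set i | (0 < phi i)%R]%SET| <= #|V|)%N ->
  2 * alpha * \sum_i phi i <= \sum_i \sum_k (G i k)%:R * `|phi i - phi k|.
Proof.
move En : #|[set i | (0 < phi i)%R]%SET| => n.
elim/ltn_ind: n phi En => n IH phi En phi0 card_le.
set S := [set i | (0 < phi i)%R]%SET in En.
have [S0|[i0 i0S]] := set_0Vmem S.
  have phiE i : phi i = 0.
    apply/eqP; rewrite eq_le phi0 andbT leNgt.
    by have : i \notin S by [rewrite S0 finset.in_set0]; rewrite inE.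
  rewrite big1 // mulr0; apply: sumr_ge0 => i _; apply: sumr_ge0 => k _.
  by rewrite mulr_ge0.
(* Subtracting the smallest positive value [m] on the support [S] makes the support strictly
   smaller, and lowers the total variation by [m] times the cut of [S], counted in both
   orientations. *)
have [i1 i1S mini1] := @arg_minP _ _ _ i0 (fun i => i \in S) phi i0S.
set m := phi i1 in mini1.
have m_gt0 : 0 < m by move: i1S; rewrite inE.
pose psi i := phi i - m * (i \in S)%:R.
have psi0 i : 0 <= psi i.
  rewrite /psi; have [iS|_] := boolP (i \in S); last by rewrite mulr0 subr0.
  by rewrite mulr1 subr_ge0 mini1.
have sub : [set i | (0 < psi i)%R]%SET \proper S.
  apply/properP; split.
    apply/fintype.subsetP => i; rewrite inE /psi => Hi.
    have [//|iS] := boolP (i \in S).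
    by move: Hi; rewrite (negPf iS) mulr0 subr0 => Hi; move: iS; rewrite inE Hi.
  exists i1 => //; by rewrite inE /psi i1S mulr1 subrr ltxx.
have lt_n : (#|[set i | (0 < psi i)%R]%SET| < n)%N by rewrite -En proper_card.
have := IH _ lt_n psi erefl psi0.
have -> : (2 * #|[set i | (0 < psi i)%R]%SET| <= #|V|)%N.
  by apply: leq_trans card_le; rewrite leq_mul2l ltnW.
move=> /(_ isT) IHpsi.
have := @expansion S; rewrite En => /(_ _ card_le) expS.
have {}expS : alpha * n%:R <= cut S.
  by apply: expS; rewrite -En; apply/card_gt0P; exists i0.
have -> : \sum_i phi i = \sum_i psi i + m * n%:R.
  rewrite -En -sum1_card natr_sum mulr_sumr [X in _ + X]big_mkcond -big_split /=.
  by apply: eq_bigr => i _; rewrite /psi; case: (i \in S); rewrite ?mulr1 ?mulr0; ring.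
have -> : \sum_i \sum_k (G i k)%:R * `|phi i - phi k| =
    \sum_i \sum_k (G i k)%:R * `|psi i - psi k| + m * (2 * cut S).
  rewrite -cutE mulr_sumr -big_split /=; apply: eq_bigr => i _.
  rewrite mulr_sumr -big_split /=; apply: eq_bigr => k _.
  rewrite mulrCA -mulrDr; congr (_ * _).
  have out l : l \notin S -> phi l = 0.
    by rewrite inE -leNgt => H; apply/eqP; rewrite eq_le H phi0.
  have := psi0 i; have := psi0 k; rewrite /psi.
  have [iS|/out iS] := boolP (i \in S); have [kS|/out kS] := boolP (k \in S);
    rewrite ?iS ?kS /= ?mulr1 ?mulr0 ?subr0 ?sub0r ?subrr ?normrN ?normr0 ?normr1
      ?mulr0 ?addr0 ?mulr1 //.
  - by move=> _ _; congr `|_|; ring.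
  - by move=> _ H; rewrite !ger0_norm //; ring.
  - by move=> H _; rewrite !ger0_norm //; ring.
have := ler_wpM2l (ltW m_gt0) expS; lra.
Qed.

(** Cheeger's argument: the coarea inequality is applied to [psi ^ 2], and |x ^ 2 - y ^ 2| = |x - y|
    (x + y) is split by AM-GM. With weight [alpha / (2 * D)], the degree bound turns the second part
    into [alpha] times the sum of squares, half of the left-hand side. *)
Lemma sum_sqr_le_energy psi :
    (forall i, 0 <= psi i) -> (2 * #|[set i | (0 < psi i)%R]%SET| <= #|V|)%N ->
  \sum_i psi i ^+ 2 <= D / alpha ^+ 2 * energy G psi.
Proof.
move=> psi0 card_le.
have := @cut_coarea (fun i => psi i ^+ 2) (fun i => sqr_ge0 _).
have -> : [set i | (0 < psi i ^+ 2)%R]%SET = [set i | (0 < psi i)%R]%SET.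
  by apply/setP => i; rewrite !inE [RHS]lt0r psi0 andbT exprn_even_gt0.
move=> /(_ card_le) H.
have : \sum_i \sum_k (G i k)%:R * `|psi i ^+ 2 - psi k ^+ 2| <=
    D / alpha * energy G psi + alpha * \sum_i psi i ^+ 2.
  have HD : \sum_i \sum_k (G i k)%:R * (psi i ^+ 2 + psi k ^+ 2) <=
      2 * D * \sum_i psi i ^+ 2.
    have E : \sum_i \sum_k (G i k)%:R * psi i ^+ 2 <= D * \sum_i psi i ^+ 2.
      rewrite mulr_sumr; apply: ler_sum => i _; rewrite -mulr_suml -degreeE.
      by rewrite ler_wpM2r ?sqr_ge0.
    have E' : \sum_i \sum_k (G i k)%:R * psi k ^+ 2 <= D * \sum_i psi i ^+ 2.
      rewrite exchange_big /=; apply: le_trans E; apply: ler_sum => i _.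
      by apply: ler_sum => k _; rewrite adj_sym.
    under eq_bigr do (under eq_bigr do rewrite mulrDr; rewrite big_split).
    rewrite big_split /=; lra.
  have a2D : 0 < alpha / (2 * D) by rewrite divr_gt0 ?mulr_gt0.
  have := ler_wpM2l (ltW a2D) HD.
  have -> : alpha / (2 * D) * (2 * D * \sum_i psi i ^+ 2) = alpha * \sum_i psi i ^+ 2.
    by field; rewrite gt_eqF.
  move=> HD'; apply: (le_trans _ (lerD (lexx _) HD')).
  rewrite /energy !mulr_sumr -big_split /=; apply: ler_sum => i _.
  rewrite !mulr_sumr -big_split /=; apply: ler_sum => k _.
  rewrite !(mulrCA _ (G i k)%:R) -mulrDr ler_wpM2l // subr_sqr normrM.
  rewrite (ger0_norm (addr_ge0 (psi0 i) (psi0 k))).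
  set x := psi i; set y := psi k; rewrite -subr_ge0.
  have -> : D / alpha * (x - y) ^+ 2 = D / alpha * `|x - y| ^+ 2.
    by rewrite real_normK ?num_real.
  have -> : D / alpha * `|x - y| ^+ 2 + alpha / (2 * D) * (x ^+ 2 + y ^+ 2) -
      `|x - y| * (x + y) = (D / alpha) * (`|x - y| - alpha / (2 * D) * (x + y)) ^+ 2
      + alpha / (4 * D) * (x - y) ^+ 2.
    by move: `|x - y| => z; field; rewrite !gt_eqF.
  by rewrite addr_ge0 // mulr_ge0 ?sqr_ge0 // divr_ge0 ?mulr_ge0 // ltW.
move=> /(le_trans H); set A := \sum_i _; set E := energy G psi => H2.
have {}H2 : alpha * A <= D / alpha * E by lra.
have -> : D / alpha ^+ 2 * E = alpha^-1 * (D / alpha * E) by field; rewrite gt_eqF.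
by rewrite -ler_pdivrMl ?invr_gt0 // invrK.
Qed.

Lemma exists_median f : exists m : R,
  (2 * #|[set i | (m < f i)%R]%SET| <= #|V|)%N /\
  (2 * #|[set i | (f i < m)%R]%SET| <= #|V|)%N.
Proof.
have [V0|V0] := posnP #|V|.
  have c0 (S : {set V}) : #|S| = 0%N by apply/eqP; rewrite -leqn0 -V0 max_card.
  by exists 0; rewrite !c0.
have /card_gt0P[i0 _] := V0.
have [imin _ Himin] := @arg_minP _ _ _ i0 xpredT f isT.
pose P i := (2 * #|[set k | (f k < f i)%R]%SET| <= #|V|)%N.
have Pmin : P imin.
  rewrite /P (_ : [set k | _]%SET = finset.set0) ?cards0 ?muln0 //.
  by apply/setP => k; rewrite !inE ltNge Himin.
(* The median is the largest value of [f] with at most half of the vertices strictly below it. The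
   next larger value has more than half strictly below, and the vertices not below it are exactly
   those above the median. *)
have [i1 Pi1 max1] := arg_maxP f Pmin.
exists (f i1); split => //.
have [->|[i2 i2S]] := set_0Vmem [set i | (f i1 < f i)%R]%SET.
  by rewrite cards0 muln0.
have [i3 i3S min3] := @arg_minP _ _ _ i2 (fun i => i \in _) f i2S.
have {}i3S : f i1 < f i3 by move: i3S; rewrite /= inE.
have nP3 : ~~ P i3.
  by apply/negP => /max1 H; have : f i3 <= f i1 := H; rewrite leNgt i3S.
rewrite /P -ltnNge in nP3.
have EC : ([set k | (f k < f i3)%R] = ~: [set i | (f i1 < f i)%R])%SET.
  apply/setP => k; rewrite !inE -leNgt; apply/idP/idP => Hk.
    rewrite leNgt; apply/negP => H; have := min3 k; rewrite inE => /(_ H).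
    by rewrite leNgt Hk.
  exact: le_lt_trans Hk i3S.
have := cardsC [set i | (f i1 < f i)%R]%SET; rewrite -EC => EQ.
by rewrite -EQ mul2n -addnn leq_add2l; move: nP3; rewrite -EQ mul2n -addnn ltn_add2r => /ltnW.
Qed.

(** Centred at a median, the positive and negative parts of [f] each live on at most half of the
    vertices, where expansion applies. Their energies add up to at most that of [f]. *)
Lemma expansion_poincare : poincare G (D / alpha ^+ 2).
Proof.
move=> f; have [m [m1 m2]] := exists_median f; exists m.
pose fp i := Num.max (f i - m) 0; pose fn i := Num.max (m - f i) 0.
have fp0 i : 0 <= fp i by rewrite le_max lexx orbT.
have fn0 i : 0 <= fn i by rewrite le_max lexx orbT.
have Hp := @sum_sqr_le_energy fp fp0; have Hn := @sum_sqr_le_energy fn fn0.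
have {}Hp : \sum_i fp i ^+ 2 <= D / alpha ^+ 2 * energy G fp.
  apply: Hp; rewrite (_ : [set i | _]%SET = [set i | (m < f i)%R]%SET) //.
  by apply/setP => i; rewrite !inE lt_max ltxx orbF subr_gt0.
have {}Hn : \sum_i fn i ^+ 2 <= D / alpha ^+ 2 * energy G fn.
  apply: Hn; rewrite (_ : [set i | _]%SET = [set i | (f i < m)%R]%SET) //.
  by apply/setP => i; rewrite !inE lt_max ltxx orbF subr_gt0.
have K0 : 0 <= D / alpha ^+ 2 by rewrite divr_ge0 ?exprn_ge0 ?ltW.
have -> : \sum_i (f i - m) ^+ 2 = \sum_i fp i ^+ 2 + \sum_i fn i ^+ 2.
  rewrite -big_split /=; apply: eq_bigr => i _; rewrite /fp /fn -opprB.
  case: (leP (m - f i) 0) => H; [rewrite max_l|rewrite max_r]; by [lra | ring].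
apply: le_trans (lerD Hp Hn) _; rewrite -mulrDr ler_wpM2l //.
rewrite /energy -big_split /=; apply: ler_sum => i _.
rewrite -big_split /=; apply: ler_sum => k _; rewrite -mulrDr ler_wpM2l //.
rewrite /fp /fn; case: (lerP (f i - m) 0) => Hi; case: (lerP (f k - m) 0) => Hk.
- rewrite (max_l (_ : 0 <= m - f i)); last lra.
  rewrite (max_l (_ : 0 <= m - f k)); last lra.
  nra.
- rewrite (max_l (_ : 0 <= m - f i)); last lra.
  rewrite (max_r (_ : m - f k <= 0)); last lra.
  nra.
- rewrite (max_r (_ : m - f i <= 0)); last lra.
  rewrite (max_l (_ : 0 <= m - f k)); last lra.
  nra.
- rewrite (max_r (_ : m - f i <= 0)); last lra.
  rewrite (max_r (_ : m - f k <= 0)); last lra.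
  nra.
Qed.

Lemma expansion_degree_gt0 i : (1 < #|V|)%N -> (0 < degree G i)%N.
Proof.
move=> V2; have := @expansion [set i]%SET; rewrite cards1 => /(_ isT V2).
rewrite mulr1 => H; rewrite -(ltr0n R); apply: lt_le_trans alpha_gt0 _.
apply: le_trans H _; rewrite /cut (bigD1 i) //= [X in _ + X]big1 ?addr0.
  rewrite degreeE; apply: ler_sum => k _; rewrite ler_piMr //.
  by case: (_ && _).
by move=> k ki; rewrite big1 // => l _; rewrite inE (negbTE ki) mulr0.
Qed.

(** The indicator of a connected component has energy 0, hence is constant by the Poincare
    inequality. *)
Lemma expansion_connected : connected_graph G.
Proof.
apply/forallP => i; apply/forallP => k.
pose f l : R := (connect G i l)%:R.
have E0 : energy G f = 0.
  apply: big1 => l _; apply: big1 => l' _.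
  have [ll'|_] := boolP (G l l'); last by rewrite mul0r.
  rewrite /f (_ : connect G i l = connect G i l') ?subrr ?expr0n ?mulr0 //.
  apply/idP/idP => H; apply: connect_trans H _; apply: connect1 => //.
  by rewrite adj_sym.
have K0 : 0 <= D / alpha ^+ 2 by rewrite divr_ge0 ?exprn_ge0 ?ltW.
have := energy0_cst i k K0 expansion_poincare E0.
by rewrite /f connect0; case: (connect G i k) => // /eqP; rewrite oner_eq0.
Qed.

End Cheeger.

(** * Product measures on sets *)

Section ProductWeight.
Context {R : realType} {I : finType} (p : R).
Implicit Types (A D S : {set I}) (e : I) (F H : {set I} -> R) (Q : pred {set I}).
Local Open Scope set_scope.
Local Open Scope ring_scope.

(** The law of a random subset containing each element independently with probability [p]. *)
Definition weight A : R := \prod_e (if e \in A then p else 1 - p).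

Definition expect F : R := \sum_A weight A * F A.

Definition prob Q : R := \sum_(A | Q A) weight A.

Lemma expect_prod (f g : I -> R) :
  expect (fun A => \prod_e (if e \in A then f e else g e)) =
  \prod_e (p * f e + (1 - p) * g e).
Proof.
rewrite bigA_distr /=; apply: eq_bigr => A _.
by rewrite -big_split /=; apply: eq_bigr => e _; case: (e \in A).
Qed.

Lemma weight_superset S : \sum_(A : {set I} | S \subset A) weight A = p ^+ #|S|.
Proof.
have := expect_prod (fun=> 1) (fun e => (e \notin S)%:R).
rewrite (bigID [in S]) /= (eq_bigr (fun=> p)) => [|e ->]; last first.
  by rewrite mulr1 mulr0 addr0.
rewrite prodr_const [X in _ * X]big1 => [|e ->]; last by rewrite !mulr1 addrC subrK.
rewrite mulr1 => <-; rewrite big_mkcond; apply: eq_bigr => A _.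
case: ifP => [/fintype.subsetP SA|].
  rewrite big1 ?mulr1 // => e _; case: ifP => // eA; case: (boolP (e \in S)) => // /SA.
  by rewrite eA.
move=> /negbT /fintype.subsetPn[e eS eA]; rewrite (bigD1 e) //= (negbTE eA) eS.
by rewrite mul0r mulr0.
Qed.

Lemma weight_sum1 : \sum_A weight A = 1.
Proof.
have := weight_superset finset.set0; rewrite cards0 expr0 => <-.
by apply: eq_bigl => A; rewrite finset.sub0set.
Qed.

Lemma expect_cst c : expect (fun=> c) = c.
Proof. by rewrite /expect -mulr_suml weight_sum1 mul1r. Qed.

Lemma expectZ c F : expect (fun A => c * F A) = c * expect F.
Proof. by rewrite /expect mulr_sumr; apply: eq_bigr => A _; rewrite mulrCA. Qed.

Lemma expectD F H : expect (fun A => F A + H A) = expect F + expect H.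
Proof. by rewrite /expect -big_split; apply: eq_bigr => A _; rewrite mulrDr. Qed.

Lemma expect_sum (J : finType) (P : pred J) (F : J -> {set I} -> R) :
  expect (fun A => \sum_(k | P k) F k A) = \sum_(k | P k) expect (F k).
Proof.
rewrite /expect exchange_big /=; apply: eq_bigr => A _.
by rewrite mulr_sumr.
Qed.

Lemma eq_expect F H : F =1 H -> expect F = expect H.
Proof. by move=> FH; apply: eq_bigr => A _; rewrite FH. Qed.

Lemma weight_rest e A : e \notin A ->
  exists w, weight A = (1 - p) * w /\ weight (e |: A) = p * w.
Proof.
move=> eA; exists (\prod_(e' | e' != e) (if e' \in A then p else 1 - p)).
rewrite /weight (bigD1 e) //= (negbTE eA); split => //.
rewrite (bigD1 e) //= finset.setU11; congr (_ * _); apply: eq_bigr => e' /negbTE ee'.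
by rewrite finset.in_setU1 ee'.
Qed.

Lemma sum_setU1 e F :
  \sum_A F A = \sum_(A : {set I} | e \notin A) (F A + F (e |: A)).
Proof.
rewrite (bigID (fun A : {set I} => e \in A)) /= addrC big_split /=; congr (_ + _).
rewrite (reindex_onto (fun A => e |: A) (fun A => A :\ e)) /=; last first.
  by move=> A eA; rewrite finset.setD1K.
apply: eq_bigl => A; rewrite finset.setU11 /=.
by apply/eqP/idP => [<-|eA]; [rewrite finset.setD11|rewrite finset.setU1K].
Qed.

(** Discrete integration by parts: given the other elements, [e] is present with weight [p] and
    absent with weight [1 - p], and the centred indicator is then [1 - p] or [- p]. Both the
    variance formula and Stein's identity rest on it. *)
Lemma expect_swap e F :
  expect (fun A => ((e \in A)%:R - p) * F A) =
  p * (1 - p) * expect (fun A => F (e |: A) - F (A :\ e)).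
Proof.
rewrite /expect mulr_sumr !(sum_setU1 e); apply: eq_bigr => A eA.
have [w [-> ->]] := weight_rest eA.
have -> : A :\ e = A by apply/finset.setDidPl; rewrite disjoint_sym finset.disjoints1.
by rewrite finset.setUA finset.setUid finset.setU11 (negbTE eA) finset.setU1K //=; ring.
Qed.

Lemma expect_variance (c : I -> R) :
  expect (fun A => (\sum_e c e * ((e \in A)%:R - p)) ^+ 2) =
  p * (1 - p) * \sum_e c e ^+ 2.
Proof.
pose F A := \sum_e c e * ((e \in A)%:R - p).
transitivity (expect (fun A => \sum_e c e * (((e \in A)%:R - p) * F A))).
  apply: eq_expect => A; rewrite expr2 -/(F A) {1}/F mulr_suml.
  by apply: eq_bigr => e _; rewrite mulrA.
rewrite expect_sum mulr_sumr; apply: eq_bigr => e _.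
rewrite expectZ expect_swap (@eq_expect _ (fun=> c e)) ?expect_cst; last first.
  move=> A; rewrite /F (bigD1 e) //= [X in _ - X](bigD1 e) //= finset.setU11 finset.setD11.
  rewrite (eq_bigr (fun e' => c e' * ((e' \in A :\ e)%:R - p))) => [|e' /negbTE ee'].
    by rewrite /=; ring.
  by rewrite finset.in_setU1 finset.in_setD1 ee'.
ring.
Qed.

Hypothesis p01 : 0 <= p <= 1.

Let p_ge0 : 0 <= p. Proof. by case/andP: p01. Qed.
Let p_le1 : 0 <= 1 - p. Proof. by rewrite subr_ge0; case/andP: p01. Qed.

Lemma weight_ge0 A : 0 <= weight A.
Proof. by apply: prodr_ge0 => e _; case: ifP. Qed.

Lemma ler_expect F H : (forall A, F A <= H A) -> expect F <= expect H.
Proof. by move=> FH; apply: ler_sum => A _; rewrite ler_wpM2l ?weight_ge0. Qed.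

Lemma expect_norm F : `|expect F| <= expect (fun A => `|F A|).
Proof.
apply: (le_trans (ler_norm_sum _ _ _)); apply: ler_sum => A _.
by rewrite normrM ger0_norm ?weight_ge0.
Qed.

Lemma probE Q : prob Q = expect (fun A => (Q A)%:R).
Proof.
rewrite /prob big_mkcond; apply: eq_bigr => A _.
by case: (Q A); rewrite ?mulr1 ?mulr0.
Qed.

Lemma ler_prob Q Q' : subpred Q Q' -> prob Q <= prob Q'.
Proof.
move=> QQ'; rewrite !probE; apply: ler_expect => A; rewrite ler_nat.
by case: (boolP (Q A)) => // /QQ' ->.
Qed.

Lemma prob_predC Q : prob Q = 1 - prob (predC Q).
Proof. by rewrite -weight_sum1 (bigID Q) /= addrK. Qed.

Lemma prob_le_expect Q F : (forall A, 0 <= F A) -> (forall A, Q A -> 1 <= F A) ->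
  prob Q <= expect F.
Proof.
move=> F0 F1; rewrite probE; apply: ler_expect => A.
by case: (boolP (Q A)) => // /F1.
Qed.

Lemma prob_predU Q Q' : prob (predU Q Q') <= prob Q + prob Q'.
Proof.
rewrite !probE -expectD; apply: ler_expect => A /=.
by case: (Q A); case: (Q' A); rewrite /= ?addr0 ?add0r // lerDl.
Qed.

Lemma prob_has (J : finType) (P : pred J) (Q : J -> pred {set I}) :
  prob (fun A => [exists j, P j && Q j A]) <= \sum_(j | P j) prob (Q j).
Proof.
under eq_bigr do rewrite probE; rewrite -expect_sum.
apply: prob_le_expect => A; first by apply: sumr_ge0 => *; exact: ler0n.
move=> /existsP[j /andP[Pj Qj]]; rewrite (bigD1 j) //= Qj lerDl.
by apply: sumr_ge0 => *; exact: ler0n.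
Qed.

Lemma chebyshev_weight (c : I -> R) (t : R) : 0 < t ->
  prob (fun A => t < `|\sum_e c e * ((e \in A)%:R - p)|) <=
  p * (1 - p) * (\sum_e c e ^+ 2) / t ^+ 2.
Proof.
move=> t0; rewrite -expect_variance mulrC -expectZ.
apply: prob_le_expect => A; first by rewrite mulr_ge0 ?sqr_ge0 // invr_ge0 sqr_ge0.
move=> tA; rewrite ler_pdivlMl ?exprn_gt0 // mulr1 -[leRHS]real_normK ?num_real //.
by rewrite lerXn2r ?nnegrE ?(ltW t0) // ltW.
Qed.

Lemma expect_mgf D x : expect (fun A => x ^+ #|A :&: D|) = (1 - p + p * x) ^+ #|D|.
Proof.
have := expect_prod (fun e => if e \in D then x else 1) (fun=> 1).
rewrite (bigID [in D]) /= (eq_bigr (fun=> 1 - p + p * x)) => [|e ->]; last first.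
  by rewrite mulr1 addrC.
rewrite prodr_const [X in _ * X]big1 => [|e /negbTE ->]; last by rewrite !mulr1 addrC subrK.
rewrite mulr1 => <-; apply: eq_expect => A.
rewrite -prodr_const big_mkcond; apply: eq_bigr => e _.
by rewrite finset.in_setI; case: (e \in A).
Qed.

Lemma expect_mgf_le D x : 0 <= x ->
  expect (fun A => x ^+ #|A :&: D|) <= expR (p * #|D|%:R * (x - 1)).
Proof.
move=> x0; rewrite expect_mgf mulrAC expRM_natr lerXn2r ?nnegrE ?expR_ge0 //.
  by rewrite addr_ge0 ?mulr_ge0.
by apply: le_trans (expR_ge1Dx _); lra.
Qed.

Lemma expRN1_half : expR (- 1) <= 1 / 2 :> R.
Proof.
rewrite expRN -[1 / 2]invrK invf_div divr1 lef_pV2 ?posrE ?expR_gt0 //.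
by have := expR_ge1Dx (1 : R); lra.
Qed.

(** Exponential Markov inequality with base e ^ -1, for which 1 - e ^ -1 >= 1 / 2. *)
Lemma chernoff_lower D (a : R) :
  prob (fun A => #|A :&: D|%:R <= a) <= expR (a - p * #|D|%:R / 2).
Proof.
rewrite expRD; set b := expR (- _).
have : expect (fun A => expR (- 1) ^+ #|A :&: D|) <= b.
  apply: (le_trans (expect_mgf_le _ (expR_ge0 _))); rewrite ler_expR.
  have := expRN1_half; have : 0 <= p * #|D|%:R by rewrite mulr_ge0.
  nra.
move=> H; apply: le_trans (ler_wpM2l (expR_ge0 a) H); rewrite -expectZ.
apply: prob_le_expect => A; first by rewrite mulr_ge0 ?exprn_ge0 ?expR_ge0.
by move=> Xa; rewrite -expRM_natr mulN1r -expRD -[leLHS]expR0 ler_expR subr_ge0.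
Qed.

(** Exponential Markov inequality with base e ^ (1 / 2), which is at most 2. *)
Lemma chernoff_upper D (a : R) :
  prob (fun A => a <= #|A :&: D|%:R) <= expR (p * #|D|%:R - a / 2).
Proof.
rewrite expRD mulrC; set b := expR (p * _).
have e2 : expR (2^-1) <= 2 :> R.
  have := expR_ge1Dx (- (2^-1) : R); rewrite expRN => H.
  by rewrite -[expR _]invrK -[leRHS]invrK lef_pV2 ?posrE ?invr_gt0 ?expR_gt0 //; lra.
have : expect (fun A => expR (2^-1) ^+ #|A :&: D|) <= b.
  apply: (le_trans (expect_mgf_le _ (expR_ge0 _))); rewrite ler_expR.
  have : 0 <= p * #|D|%:R by rewrite mulr_ge0.
  nra.
move=> H; apply: le_trans (ler_wpM2l (expR_ge0 _) H); rewrite -expectZ.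
apply: prob_le_expect => A; first by rewrite mulr_ge0 ?exprn_ge0 ?expR_ge0.
by move=> Xa; rewrite -expRM_natr -expRD -[leLHS]expR0 ler_expR; lra.
Qed.

End ProductWeight.

(** * The law of a random set from its inclusion probabilities *)

Section RandomSet.
Context {d : measure_display} {T : measurableType d} {R : realType}.
Context (P : probability T R) {I : finType} (E : T -> {set I}) (p : R).
Hypothesis mE : forall e, measurable [set w | e \in E w].
Hypothesis pE : forall S : {set I},
  P (\bigcap_(e in [set` S]) [set w | e \in E w]) = (p ^+ #|S|)%:E.

Let measurable_atom (A : {set I}) : measurable [set w | E w = A].
Proof.
have -> : [set w | E w = A] = \big[setI/setT]_(e : I)
    (if e \in A then [set w | e \in E w] else ~` [set w | e \in E w]).
  rewrite -bigcap_seq; apply/seteqP; split => [w /= <- e _|w /= H].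
    by case: ifP => //= ->.
  apply/setP => e; have := H e; rewrite /= mem_index_enum => /(_ isT).
  by case: ifP => /= eA // /negP/negbTE.
by apply: bigsetI_measurable => e _; case: ifP => _ //; exact: measurableC.
Qed.

Let P_sum (r : seq {set I}) : uniq r ->
  measurable [set w | E w \in r] /\
  P [set w | E w \in r] = (\sum_(A <- r) P [set w | E w = A])%E.
Proof.
elim: r => [_|A r IH /= /andP[Ar /IH[mr Pr]]].
  rewrite (_ : [set w | _] = set0); first by rewrite measure0 big_nil.
  by apply/seteqP; split => w.
have -> : [set w | E w \in A :: r] = [set w | E w = A] `|` [set w | E w \in r].
  apply/seteqP; split => w /=; rewrite inE; first by move=> /orP[/eqP|]; [left|right].
  by case=> ->; rewrite ?eqxx ?orbT.
split; first exact: measurableU.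
rewrite measureU //; first by rewrite big_cons -Pr.
by apply/seteqP; split => w //= [->]; rewrite (negbTE Ar).
Qed.

Let P_pred (Q : pred {set I}) :
  P [set w | Q (E w)] = (\sum_(A | Q A) P [set w | E w = A])%E.
Proof.
have [_] := P_sum (filter_uniq Q (index_enum_uniq {set I})).
rewrite big_filter => <-; congr (P _); apply/seteqP.
by split => w /=; rewrite mem_filter mem_index_enum andbT.
Qed.

(** Moebius inversion by induction on the complement of [A]: the probability of containing [A] is
    known for both laws, and on all strict supersets of [A] the two already agree. *)
Let P_atom (A : {set I}) : P [set w | E w = A] = (weight p A)%:E.
Proof.
move En : #|~: A| => n.
elim/ltn_ind: n A En => n IH A En.
have := P_pred (fun B : {set I} => A \subset B).
have -> : [set w | (A \subset E w)%SET] =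
    \bigcap_(e in [set` A]) [set w | e \in E w].
  apply/seteqP; split => [w /= /fintype.subsetP H e /= /H //|w /= H].
  by apply/fintype.subsetP => e /H.
rewrite pE -weight_superset (bigD1 A) //= [in RHS](bigD1 A) //=.
have -> : (\sum_(B : {set I} | (A \subset B) && (B != A)) P [set w | E w = B] =
    (\sum_(B : {set I} | (A \subset B) && (B != A)) weight p B)%:E)%E.
  rewrite -sumEFin; apply: eq_bigr => B /andP[AB BA].
  apply: (IH #|~: B|) => //; rewrite -En; apply: proper_card.
  by rewrite finset.properC finset.properEneq eq_sym BA.
have : P [set w | E w = A] \is a fin_num by exact: fin_num_measure.
case: (P _) => // r _; rewrite -EFinD => -[] /eqP; rewrite eq_sym.
by rewrite -subr_eq addrK => /eqP ->.
Qed.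

Lemma random_set_prob (Q : pred {set I}) :
  P [set w | Q (E w)] = (prob p Q)%:E.
Proof. by rewrite P_pred -sumEFin; apply: eq_bigr. Qed.

End RandomSet.

(** * Stein's equation *)

Section CompactSupport.
Context {R : realType}.
Implicit Types (g h : R -> R) (K : R).

Definition supported_in K h := forall x, K <= `|x| -> h x = 0.

Lemma supported_unif_continuous K g : continuous g -> supported_in K g ->
  forall eps : R, 0 < eps -> exists2 delta : R, 0 < delta &
    forall x y, `|x - y| <= delta -> `|g x - g y| <= eps.
Proof.
move=> cg sg eps eps0.
have /compact_near_coveringP cov := @segment_compact R (- (K + 1)) (K + 1).
pose Q (delta x : R) := forall y, `|x - y| <= delta -> `|g x - g y| <= eps.
have near_x (x : R) : \forall x' \near x & delta \near (0 : R)^'+, Q delta x'.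
  have e2 : 0 < eps / 2 by rewrite divr_gt0.
  have /cvgrPdist_lt/(_ _ e2)[r /= r0 Hr] := cg x.
  exists ((ball x (r / 2)), [set dd | dd < r / 2]) => /=.
    split; first by apply: nbhsx_ballx; rewrite divr_gt0.
    by apply: nbhs_right_lt; rewrite divr_gt0.
  move=> [x' dd] /= [xx' ddr] y x'y.
  have H1 := Hr x'; have H2 := Hr y; rewrite /ball /= in xx' H1 H2.
  have {}H1 : `|g x - g x'| < eps / 2 by apply: H1; lra.
  have {}H2 : `|g x - g y| < eps / 2.
    apply: H2; apply: le_lt_trans (ler_distD x' x y) _.
    by rewrite [ltRHS]splitr ltrD // (le_lt_trans x'y).
  apply: le_trans (ler_distD (g x) (g x') (g y)) _.
  by rewrite (distrC (g x')) [leRHS]splitr ltW // ltrD.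
have near0 : \forall delta \near (0 : R)^'+, `[- (K + 1), K + 1]%classic `<=` Q delta.
  by apply: cov => x _; exact: near_x.
(* The interval exceeds the support by 1 on each side and [dd <= 1]: a point outside it and any
   point within [dd] of it both lie where [g] vanishes. *)
have [dd [dd0 dd1 Hdd]] : exists dd : R, [/\ 0 < dd, dd <= 1 &
    forall x, `[- (K + 1), K + 1]%classic x -> Q dd x].
  near (0 : R)^'+ => dd; exists dd; split => //.
    by near: dd; exact: nbhs_right_le.
  by near: dd; exact: near0.
exists dd => // x y xy.
have [xK|xK] := lerP `|x| (K + 1).
  by apply: Hdd => //=; rewrite in_itv /= -ler_norml.
rewrite (sg x) ?(sg y) ?subrr ?normr0 ?ltW //; last by lra.
have := lerB_dist x (x - y); rewrite opprB addrCA subrr addr0; lra.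
Unshelve. all: by end_near.
Qed.

End CompactSupport.

Section SteinEquation.
Context {R : realType}.
Implicit Types (f g h : R -> R) (K M x : R).
Local Notation mu := (@lebesgue_measure R).
Local Notation phi := (normal_pdf (0 : R) 1).

Lemma scaleRE (a b : R) : a *: (b : R^o) = a * b. Proof. by []. Qed.

Definition gauss_mean h : R := \int[mu]_t (h t * phi t).

Lemma std_normal_pdfE x : phi x = normal_peak 1 * expR (- (x ^+ 2 / 2)).
Proof.
rewrite normal_pdfE ?oner_neq0 // /normal_fun subr0 expr1n mulNr.
by [].
Qed.

Lemma integrable_gauss h M : continuous h -> (forall x, `|h x| <= M) ->
  mu.-integrable setT (EFin \o (fun t => h t * phi t)).
Proof.
move=> ch hM.
have M0 : 0 <= M by exact: le_trans (normr_ge0 _) (hM 0).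
apply: (@le_integrable _ _ _ mu _ measurableT _ (fun t => (M%:E * (phi t)%:E)%E)).
- apply/measurable_EFinP; apply: measurable_funM.
    exact: continuous_measurable_fun.
  exact: measurable_normal_pdf.
- move=> t _ /=; rewrite lee_fin !normrM ler_wpM2r //.
  by rewrite (ger0_norm M0).
- by apply: integrableZl => //; exact: integrable_normal_pdf.
Qed.

(** The solution is f(x) = phi(x) ^ -1 times the integral of [h * phi] up to x. Left of the support
    this integral is 0; right of it, it is the full Gaussian mean, which is 0 by hypothesis. Hence
    [f] and its derivative vanish where [h] does by support. *)
Lemma stein_solution h K M : continuous h -> (forall x, `|h x| <= M) ->
    supported_in K h -> gauss_mean h = 0 ->
  exists f df : R -> R, [/\ forall x, is_derive x 1 f (df x),
    forall x, h x = df x - x * f x, continuous df & supported_in K df].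
Proof.
move=> ch hM hK h0.
pose g t := h t * phi t.
have ig : mu.-integrable setT (EFin \o g) by exact: integrable_gauss hM.
pose F x := \int[mu]_(t in `]-oo, x]) g t.
pose E x := (normal_peak 1)^-1 * expR (x ^+ 2 / 2).
have cphi : continuous phi by apply: continuous_normal_pdf; exact: oner_neq0.
have dF x : is_derive x 1 F (g x).
  have [|||Fd FE] := @continuous_FTC1 R g -oo%O x (x + 1) _ _ (ltNyr _).
  - by rewrite ltrDl.
  - exact: integrableS ig.
  - by apply: cvgM; [exact: ch|exact: cphi].
  - by apply: DeriveDef; [exact: Fd|rewrite -derive1E; exact: FE].
have dE x : is_derive x 1 E (x * E x).
  rewrite /E.
  have H : is_derive x 1 (2^-1 \*: (@id R ^+ 2)) x.
    by apply: is_derive_eq; rewrite !scaleRE /= expr1; field.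
  have HE : is_derive x 1 ((normal_peak 1)^-1 \*: (expR \o (2^-1 \*: (@id R ^+ 2))))
      (x * E x).
    apply: is_derive_eq; rewrite !scaleRE /E /= scaleRE (mulrC (x ^+ 2)).
    by ring.
  congr (is_derive x 1 _ _) : HE; apply/funext => y.
  by rewrite /E /= scaleRE (mulrC (y ^+ 2)).
have Ephi x : phi x * E x = 1.
  rewrite std_normal_pdfE /E expRN mulrACA divff ?mulVf ?mul1r //.
  - by rewrite gt_eqF ?expR_gt0.
  - by rewrite gt_eqF // normal_peak_gt0 ?oner_neq0.
pose f x := F x * E x.
have df x : is_derive x 1 f (x * f x + h x).
  have H : is_derive x 1 (F * E) (x * f x + h x); last exact: H.
  apply: is_derive_eq; rewrite /f /g !scaleRE.
  have := Ephi x; move: (phi x) (E x) (F x) (h x) => a b c e ab.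
  by transitivity (c * (x * b) + e * (a * b)); [ring|rewrite ab; ring].
exists f, (fun x => x * f x + h x); split => // [x||x xK].
- by rewrite addrAC subrr add0r.
- move=> x; apply: cvgD; last exact: ch.
  apply: cvgM; first exact: cvg_id.
  apply: differentiable_continuous; apply/derivable1_diffP; exact: ex_derive.
rewrite hK // addr0 /f (_ : F x = 0) ?mul0r ?mulr0 //.
have [x0|x0] := lerP 0 x.
  rewrite -h0 /gauss_mean /F Rintegral_mkcond; apply: eq_Rintegral => t _.
  rewrite /patch; case: ifPn => // /negP xt; rewrite hK ?mul0r //.
  apply: (le_trans xK); rewrite (ger0_norm x0) (le_trans _ (ler_norm t)) // ltW //.
  by rewrite ltNge; apply/negP => tx; apply: xt; rewrite inE /= in_itv.
rewrite /F (_ : \int[mu]_(t in _) _ = \int[mu]_(t in `]-oo, x]) cst 0 t); last first.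
  apply: eq_Rintegral => t; rewrite inE /= in_itv /= => tx; rewrite /g hK ?mul0r //.
  apply: (le_trans xK); rewrite !ltr0_norm ?lerN2 //.
  exact: le_lt_trans tx x0.
by rewrite Rintegral_cst ?mul0r.
Qed.

End SteinEquation.

(** * The binomial central limit theorem *)

Section SteinBinomial.
Context {R : realType}.
Local Open Scope set_scope.
Local Open Scope ring_scope.

Definition binomial_sd (I : finType) (p : R) (D : {set I}) : R :=
  Num.sqrt (#|D|%:R * p * (1 - p)).

(** The sign is opposite to the usual one, since a larger degree of the target makes it easier to
    hit. *)
Definition standardized (I : finType) (p : R) (D A : {set I}) : R :=
  (p * #|D|%:R - #|A :&: D|%:R) / binomial_sd p D.

Section FixedWeight.
Context {I : finType} (p : R) (D : {set I}).
Hypothesis p01 : 0 < p < 1.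
Hypothesis sd_gt0 : 0 < binomial_sd p D.
Local Notation sigma := (binomial_sd p D).
Local Notation Z := (standardized p D).

Let p_ge0_le1 : 0 <= p <= 1. Proof. by case/andP: p01 => *; rewrite !ltW. Qed.

Let sd_sqr : sigma ^+ 2 = #|D|%:R * p * (1 - p).
Proof. by case/andP: p01 => p0 p1; rewrite sqr_sqrtr // !mulr_ge0 // ?subr_ge0 ltW. Qed.

Lemma centered_card (A : {set I}) :
  #|A :&: D|%:R - p * #|D|%:R = \sum_(e in D) ((e \in A)%:R - p).
Proof.
rewrite sumrB sumr_const -[p *+ _]mulr_natr; congr (_ - _).
rewrite -sum1_card natr_sum big_mkcond [RHS]big_mkcond /=.
by apply: eq_bigr => e _; rewrite finset.in_setI; case: (e \in A); case: (e \in D).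
Qed.

Lemma standardized_sum A :
  Z A = \sum_e (if e \in D then - sigma^-1 else 0) * ((e \in A)%:R - p).
Proof.
rewrite /standardized -opprB centered_card mulNr mulr_suml -sumrN big_mkcond /=.
by apply: eq_bigr => e _; case: ifP => _; [ring|rewrite mul0r].
Qed.

Lemma standardized_chebyshev (K : R) : 0 < K ->
  prob p (fun A => K < `|Z A|) <= K ^- 2.
Proof.
move=> K0; under [X in prob _ X]eq_fun do rewrite standardized_sum.
apply: (le_trans (chebyshev_weight p_ge0_le1 _ K0)).
have -> : \sum_e (if e \in D then - sigma^-1 else 0) ^+ 2 = sigma ^- 2 * #|D|%:R.
  rewrite mulr_natr -sumr_const [RHS]big_mkcond /=; apply: eq_bigr => e _.
  by case: ifP => _; rewrite ?expr0n // sqrrN exprVn.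
have s2 : sigma ^+ 2 != 0 by rewrite gt_eqF // exprn_gt0.
rewrite (_ : p * (1 - p) * (sigma ^- 2 * #|D|%:R) = sigma ^+ 2 * sigma ^- 2).
  by rewrite mulfV // mul1r.
by rewrite {2}sd_sqr; ring.
Qed.

(* By [expect_swap], E[Z f(Z)] is the average over e in D of
   sigma E[f(Z_e + 1/sigma) - f(Z_e)], where Z_e is Z after adding e to the set. *)
Lemma stein_binomial (f df : R -> R) (eps : R) :
    (forall x : R, is_derive x 1 f (df x)) ->
    (forall x y, `|x - y| <= sigma^-1 -> `|df x - df y| <= eps) ->
  `|expect p (fun A => df (Z A) - Z A * f (Z A))| <= eps.
Proof.
move=> dfP Hdf.
(* By the mean value theorem the difference quotient of [f] is [df] at a point between [z] and
   [z + sigma^-1], hence within [sigma^-1] of either endpoint. *)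
have diff z w : (w = z) \/ (w = z + sigma^-1) ->
    `|df w - sigma * (f (z + sigma^-1) - f z)| <= eps.
  move=> wz; have zs : z < z + sigma^-1 by rewrite ltrDl invr_gt0.
  have [|c] := MVT zs (fun x _ => dfP x).
    apply: derivable_within_continuous => x _; exact: ex_derive.
  rewrite in_itv /= => /andP[zc cz] ->.
  rewrite [z + _ - z]addrAC subrr add0r mulrCA divff ?mulr1 ?gt_eqF //.
  apply: Hdf; rewrite ler_norml; case: wz => ->; apply/andP; split; lra.
have Zadd e A : e \in D -> Z (A :\ e) = Z (e |: A) + sigma^-1.
  move=> eD; rewrite !standardized_sum (bigD1 e) //= [in RHS](bigD1 e) //=.
  rewrite eD finset.setD11 finset.setU11 /=.
  rewrite (eq_bigr (fun e' => (if e' \in D then - sigma^-1 else 0) * ((e' \in e |: A)%:R - p))).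
    by ring.
  by move=> e' /negbTE ee'; rewrite finset.in_setU1 finset.in_setD1 ee'.
have Zor e A : e \in D -> Z A = Z (e |: A) \/ Z A = Z (e |: A) + sigma^-1.
  move=> eD; have [eA|eA] := boolP (e \in A).
    left; congr (standardized _ _ _); apply/setP => e'.
    by rewrite finset.in_setU1; case: eqVneq => // ->.
  right; rewrite -Zadd //; congr (standardized _ _ _); apply/setP => e'.
  by rewrite finset.in_setD1; case: eqVneq => // ->; rewrite (negbTE eA).
have D0 : (#|D|%:R : R) != 0.
  by apply/eqP => H; move: sd_gt0; rewrite /binomial_sd H !mul0r sqrtr0 ltxx.
(* This is 1 / |D|, in the form that matches the factor [p * (1 - p)] of [expect_swap]. *)
pose c := p * (1 - p) / sigma ^+ 2.
have cE : c * #|D|%:R = 1.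
  rewrite /c sd_sqr; case/andP: p01 => p0 p1; field.
  by rewrite D0 !gt_eqF // subr_gt0.
have c0 : 0 <= c.
  by case/andP: p01 => p0 p1; rewrite divr_ge0 ?exprn_ge0 ?mulr_ge0 // ?subr_ge0 ltW.
have -> : expect p (fun A => df (Z A) - Z A * f (Z A)) =
    \sum_(e in D) c * expect p (fun A =>
      df (Z A) - sigma * (f (Z (e |: A) + sigma^-1) - f (Z (e |: A)))).
  have -> : expect p (fun A => df (Z A) - Z A * f (Z A)) =
      expect p (fun A => df (Z A)) + expect p (fun A => - (Z A * f (Z A))).
    by rewrite -expectD.
  have -> : expect p (fun A => - (Z A * f (Z A))) =
      \sum_(e in D) sigma^-1 * (p * (1 - p) *
        expect p (fun A => f (Z (e |: A)) - f (Z (e |: A) + sigma^-1))).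
    transitivity (expect p (fun A => \sum_(e in D) sigma^-1 * (((e \in A)%:R - p) * f (Z A)))).
      apply: eq_expect => A; rewrite -mulr_sumr -mulr_suml -centered_card /standardized.
      by ring.
    rewrite expect_sum; apply: eq_bigr => e eD; rewrite expectZ expect_swap.
    by congr (_ * (_ * _)); apply: eq_expect => A; rewrite Zadd.
  have -> : expect p (fun A => df (Z A)) = \sum_(e in D) c * expect p (fun A => df (Z A)).
    by rewrite sumr_const -[RHS]mulr_natr mulrAC cE mul1r.
  rewrite -big_split /=.
  apply: eq_bigr => e eD; rewrite -!expectZ -expectD; apply: eq_expect => A.
  by rewrite /c; field; rewrite gt_eqF.
apply: (le_trans (ler_norm_sum _ _ _)).
have -> : eps = \sum_(e in D) c * eps.
  by rewrite sumr_const -[RHS]mulr_natr mulrAC cE mul1r.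
apply: ler_sum => e eD; rewrite normrM (ger0_norm c0) ler_wpM2l //.
apply: (le_trans (expect_norm p_ge0_le1 _)).
rewrite -[leRHS](@expect_cst R I p eps); apply: ler_expect => // A; apply: diff.
exact: Zor.
Qed.

End FixedWeight.

(** The threshold [delta] comes from the modulus of continuity of [df] alone and so depends on [h]
    and [eps] only. This uniformity lets [p] vary with the number of vertices. *)
Lemma stein_clt (h : R -> R) (K M : R) : continuous h -> (forall x, `|h x| <= M) ->
    supported_in K h -> gauss_mean h = 0 ->
  forall eps : R, 0 < eps -> exists2 delta : R, 0 < delta &
    forall (I : finType) (D : {set I}) (p : R), 0 < p < 1 -> 0 < binomial_sd p D ->
      (binomial_sd p D)^-1 <= delta ->
    `|expect p (fun A => h (standardized p D A))| <= eps.
Proof.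
move=> ch hM hK h0 eps eps0.
have [f [df [dfP hE cdf sdf]]] := stein_solution ch hM hK h0.
have [delta delta0 Hd] := supported_unif_continuous cdf sdf eps0.
exists delta => // I D p p01 sd0 sd.
have -> : expect p (fun A => h (standardized p D A)) = expect p (fun A =>
    df (standardized p D A) - standardized p D A * f (standardized p D A)).
  by apply: eq_expect => A; rewrite hE.
apply: stein_binomial => // x y xy; apply: Hd; exact: le_trans xy sd.
Qed.

End SteinBinomial.

(** * Piecewise linear cut-off functions *)

Section Bump.
Context {R : realType}.
Implicit Types (a b eta t u x : R).

(** Truncation of [u] to [0, 1], written with absolute values so that continuity is immediate. *)
Definition clamp u : R := (1 + `|u| - `|u - 1|) / 2.

Lemma clamp0 u : u <= 0 -> clamp u = 0.
Proof. by move=> u0; rewrite /clamp !ler0_norm; [field|lra..]. Qed.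

Lemma clamp1 u : 1 <= u -> clamp u = 1.
Proof. by move=> u1; rewrite /clamp !ger0_norm; [field|lra..]. Qed.

Lemma clamp_itv u : 0 <= clamp u <= 1.
Proof.
rewrite /clamp; have := ler_normD (u - 1) 1; have := ler_normB u 1.
rewrite subrK normr1; lra.
Qed.

Lemma continuous_clamp : continuous clamp.
Proof.
move=> u; apply: cvgMl; apply: cvgB.
  by apply: cvgD; [exact: cvg_cst|apply: cvg_norm; exact: cvg_id].
by apply: cvg_norm; apply: cvgB; [exact: cvg_id|exact: cvg_cst].
Qed.

(** For [eta > 0] this is 1 on [a, b] and 0 outside [a - eta, b + eta]. *)
Definition bump a b eta t : R :=
  clamp ((b - t) / eta + 1) * clamp ((t - a) / eta + 1).

Lemma continuous_bump a b eta : continuous (bump a b eta).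
Proof.
move=> t; apply: cvgM.
  apply: (@continuous_comp _ _ _ (fun t => (b - t) / eta + 1) clamp); last first.
    exact: continuous_clamp.
  apply: cvgD; last exact: cvg_cst.
  by apply: cvgMl; apply: cvgB; [exact: cvg_cst|exact: cvg_id].
apply: (@continuous_comp _ _ _ (fun t => (t - a) / eta + 1) clamp); last first.
  exact: continuous_clamp.
apply: cvgD; last exact: cvg_cst.
by apply: cvgMl; apply: cvgB; [exact: cvg_id|exact: cvg_cst].
Qed.

Lemma bump_itv a b eta t : 0 <= bump a b eta t <= 1.
Proof.
have /andP[a0 a1] := clamp_itv ((b - t) / eta + 1).
have /andP[b0 b1] := clamp_itv ((t - a) / eta + 1).
by rewrite /bump mulr_ge0 //= mulr_ile1.
Qed.

Variable eta : R.
Hypothesis eta_gt0 : 0 < eta.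

Lemma bump1 a b t : a <= t <= b -> bump a b eta t = 1.
Proof.
move=> /andP[ta tb]; rewrite /bump !clamp1 ?mulr1 //; by rewrite lerDr divr_ge0 ?subr_ge0 // ltW.
Qed.

Lemma bump0r a b t : b + eta <= t -> bump a b eta t = 0.
Proof.
move=> H; rewrite /bump clamp0 ?mul0r // addrC -lerBrDl sub0r.
by rewrite ler_pdivrMr // mulN1r; lra.
Qed.

Lemma bump0l a b t : t <= a - eta -> bump a b eta t = 0.
Proof.
move=> H; rewrite /bump mulrC clamp0 ?mul0r // addrC -lerBrDl sub0r.
by rewrite ler_pdivrMr // mulN1r; lra.
Qed.

Lemma bump_supported a b : supported_in (`|a| + `|b| + eta) (bump a b eta).
Proof.
move=> t; have := ler_norm a; have := ler_norm (- a); have := ler_norm b.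
have := normr_ge0 a; have := normr_ge0 b; rewrite normrN => b0 a0 H1 H2 H3.
case: (ger0P t) => t0 H; [apply: bump0r|apply: bump0l]; lra.
Qed.

End Bump.

(** * Gaussian integrals, and from test functions to distribution functions *)

Section GaussMean.
Context {R : realType}.
Implicit Types (h : R -> R) (x eps eta K : R).
Local Notation mu := (@lebesgue_measure R).
Local Notation phi := (normal_pdf (0 : R) 1).
Local Notation N01 := (normal_prob (0 : R) 1).

Definition normal_cdf x : R := fine (N01 `]-oo, x]).

Let fineN (A : set (measurableTypeR R)) : fine (N01 A) = \int[mu]_t (fun t => phi t * \1_A t) t.
Proof.
rewrite /normal_prob; transitivity (\int[mu]_(t in A) phi t) => //.
rewrite Rintegral_mkcond; apply: eq_Rintegral => t _.
by rewrite /patch indicE; case: (t \in A); rewrite ?mulr1 ?mulr0.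
Qed.

Let integrable_indic (A : set (measurableTypeR R)) : measurable A ->
  mu.-integrable setT (EFin \o (fun t => phi t * \1_A t)).
Proof.
move=> mA; apply: (@le_integrable _ _ _ mu _ measurableT _ (fun t => (phi t)%:E)).
- apply/measurable_EFinP; apply: measurable_funM; first exact: measurable_normal_pdf.
  exact: measurable_indic.
- move=> t _ /=; rewrite lee_fin normrM indicE ler_piMr //.
  by case: (t \in A); rewrite ?normr1 ?normr0.
- exact: integrable_normal_pdf.
Qed.

Let norm_le1 h : (forall t, 0 <= h t <= 1) -> forall t, `|h t| <= 1.
Proof. by move=> h01 t; have /andP[h0 h1] := h01 t; rewrite ger0_norm. Qed.

Lemma gauss_mean_le h (A : set (measurableTypeR R)) : measurable A -> continuous h ->
  (forall t, 0 <= h t <= 1) -> (forall t, ~ A t -> h t = 0) ->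
  gauss_mean h <= fine (N01 A).
Proof.
move=> mA ch h01 hA; rewrite fineN; apply: le_Rintegral => //.
- exact: integrable_gauss ch (norm_le1 h01).
- exact: integrable_indic.
- move=> t _; rewrite mulrC ler_wpM2l ?normal_pdf_ge0 // indicE.
  case: (boolP (t \in A)) => [_|/negP tA]; first by have /andP[] := h01 t.
  by rewrite hA // => At; apply: tA; exact: mem_set.
Qed.

Lemma gauss_mean_le1 h : continuous h -> (forall t, 0 <= h t <= 1) ->
  gauss_mean h <= 1.
Proof.
move=> ch h01; have H : fine (N01 (setT : set (measurableTypeR R))) = 1.
  exact: (congr1 fine (probability_setT (normal_prob (0 : R) 1))).
apply: (@le_trans _ _ (fine (N01 (setT : set (measurableTypeR R))))); last by rewrite H.
by apply: gauss_mean_le => // t /(_ I).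
Qed.

Lemma gauss_mean_ge h (A : set (measurableTypeR R)) : measurable A -> continuous h ->
  (forall t, 0 <= h t <= 1) -> (forall t, A t -> h t = 1) ->
  fine (N01 A) <= gauss_mean h.
Proof.
move=> mA ch h01 hA; rewrite fineN; apply: le_Rintegral => //.
- exact: integrable_indic.
- exact: integrable_gauss ch (norm_le1 h01).
- move=> t _; rewrite mulrC ler_wpM2r ?normal_pdf_ge0 // indicE.
  by case: (boolP (t \in A)) => [/set_mem/hA -> //|_]; have /andP[] := h01 t.
Qed.

Lemma gauss_meanB (h g : R -> R) (M c : R) : continuous h -> continuous g ->
  (forall t, `|h t| <= M) -> (forall t, `|g t| <= M) ->
  gauss_mean (fun t => h t - c * g t) = gauss_mean h - c * gauss_mean g.
Proof.
move=> ch cg hM gM; have ih := integrable_gauss ch hM; have ig := integrable_gauss cg gM.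
rewrite /gauss_mean -RintegralZl // -RintegralB //.
  by apply: eq_Rintegral => t _; ring.
exact: (integrableZl measurableT c ig).
Qed.

Let N01_fin (A : set (measurableTypeR R)) : measurable A -> N01 A \is a fin_num.
Proof. by move=> mA; exact: fin_num_measure. Qed.

Lemma normal_cdfB x y : x <= y -> fine (N01 `]x, y]) = normal_cdf y - normal_cdf x.
Proof.
move=> xy; apply/eqP; rewrite eq_sym subr_eq addrC; apply/eqP.
rewrite /normal_cdf -fineD ?N01_fin //.
rewrite -measureU //.
  congr (fine (N01 _)); apply/seteqP; split => t /=; rewrite !in_itv /=.
    by have [tx|tx] := lerP t x; [left|right].
  by case=> [tx|/andP[]//]; exact: le_trans tx xy.
apply/seteqP; split => t //= [] /=; rewrite !in_itv /= => tx /andP[xt _].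
by move: tx; rewrite leNgt xt.
Qed.

(** The density is at most 1 / sqrt (2 pi) <= 1. This pays for moving the argument of the
    distribution function by a small amount. *)
Lemma normal_cdf_le x y : x <= y -> normal_cdf y <= normal_cdf x + (y - x).
Proof.
move=> xy; rewrite addrC -lerBlDr -normal_cdfB // /normal_prob.
have peak1 : normal_peak (1 : R) <= 1.
  rewrite /normal_peak -[leRHS]invr1 lef_pV2 ?posrE ?sqrtr_gt0 //.
    rewrite -[leLHS]sqrtr1 ler_wsqrtr // expr1n mul1r.
    by have := pi_ge2 R; rewrite mulr2n; lra.
  by rewrite expr1n mul1r mulrn_wgt0 ?pi_gt0.
rewrite -[leRHS]mul1r; apply: (@le_trans _ _ (\int[mu]_(t in `]x, y]) cst 1 t)).
  apply: le_Rintegral => //.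
  - by apply: integrableS (@integrable_normal_pdf R 0 1).
  - apply/integrableP; split; first by apply/measurable_EFinP; exact: measurable_cst.
    rewrite /= normr1 integral_cst //= lebesgue_measure_itv /=.
    by case: ifP; rewrite ?mul1e ?mule0 // ltry.
  - by move=> t _; apply: le_trans (normal_pdf_ub _ _ (oner_neq0 _)) peak1.
rewrite Rintegral_cst // ler_wpM2l //.
have H : mu `]x, y]%classic = (y - x)%:E.
  by rewrite lebesgue_measure_itv /= lte_fin; case: ltgtP xy => // ->; rewrite subrr.
have {}H : fine (mu `]x, y]%classic) = y - x by rewrite H.
by rewrite -H; exact: lexx.
Qed.

(** A single [K] serves for both laws: [K ^- 2] is the Chebyshev bound for the standardized binomial
    variable. *)
Lemma normal_tail eps : 0 < eps -> exists2 K : R, 1 <= K &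
  [/\ normal_cdf (- K) <= eps, 1 - eps <= fine (N01 `]- K, K]) & K ^- 2 <= eps].
Proof.
move=> eps0.
pose F n : set (measurableTypeR R) := `]- n%:R, n%:R]%classic.
have cvgF : N01 (F n) @[n --> \oo] --> 1%E.
  have <- : N01 (\bigcup_n F n) = 1%E.
    rewrite (_ : \bigcup_n F n = setT) ?probability_setT //.
    rewrite -subTset => t _; exists (Num.truncn `|t|).+1 => //; rewrite /F /= in_itv /=.
    have := truncnS_gt `|t|; rewrite ltr_norml => /andP[t1 t2].
    by rewrite t1 ltW.
  have mF n : measurable (F n) by exact: measurable_itv.
  apply: nondecreasing_cvg_mu => [//||n m nm]; first exact: bigcupT_measurable.
  apply/subsetPset => t; rewrite /F /= !in_itv /= => /andP[t1 t2].
  rewrite (le_lt_trans _ t1) ?(le_trans t2) ?ler_nat //.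
  by rewrite lerN2 ler_nat.
have fcvgF : fine (N01 (F n)) @[n --> \oo] --> (1 : R) by apply: fine_cvg.
have /cvgrPdist_le/(_ _ eps0)[n0 _ Hn0] := fcvgF.
pose n := maxn n0 (maxn 1 (Num.truncn eps^-1).+1).
have n_ge1 : 1 <= n%:R :> R by rewrite ler1n !leq_max /= orbT.
have tailn : 1 - eps <= fine (N01 (F n)).
  have := Hn0 n; rewrite /= leq_max leqnn => /(_ isT); rewrite ler_norml; lra.
exists n%:R => //; split => //.
  have n0n : - n%:R <= n%:R :> R by lra.
  have := normal_cdfB n0n; rewrite -/(F n).
  have : normal_cdf n%:R <= 1.
    by rewrite -lee_fin /normal_cdf fineK ?N01_fin // probability_le1.
  lra.
have en : eps^-1 <= n%:R.
  apply: (@le_trans _ _ (Num.truncn eps^-1).+1%:R); first exact: ltW (truncnS_gt _).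
  by rewrite ler_nat !leq_max leqnn !orbT.
rewrite -[leRHS]invrK lef_pV2 ?posrE ?invr_gt0 ?exprn_gt0 //; last lra.
by apply: (le_trans en); rewrite expr2; nra.
Qed.

Section BinomialLimit.
Local Notation sd := binomial_sd.
Local Notation Z := standardized.

Let uniformly (Q : R -> forall (I : finType), R -> {set I} -> Prop) :=
  forall eps : R, 0 < eps -> exists2 delta : R, 0 < delta &
    forall (I : finType) (D : {set I}) (p : R), 0 < p < 1 -> 0 < sd p D ->
      (sd p D)^-1 <= delta -> Q eps I p D.

Let prob_itv (I : finType) (p : R) (D : {set I}) K eps : 0 < p < 1 -> 0 < sd p D ->
  1 <= K -> K ^- 2 <= eps -> prob p (fun A => K < `|Z p D A|) <= eps.
Proof.
move=> p01 sd0 K1 Ke; apply: le_trans Ke; apply: standardized_chebyshev => //.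
exact: lt_le_trans K1.
Qed.

(** The function [h' = h - c * th] has Gaussian mean 0, so Stein's method gives E h = c E th up to
    [e1]. By the tail bounds, E th and the Gaussian mean of [th] both lie in [1 - e1, 1]. Since
    [e1 <= 1 / 2] forces [c <= 2], the total error is at most 3 [e1]. *)
Lemma expect_standardized_cvg h K : continuous h -> (forall t, 0 <= h t <= 1) ->
    supported_in K h ->
  uniformly (fun eps I p D =>
    `|expect p (fun A => h (Z p D A)) - gauss_mean h| <= eps).
Proof.
move=> ch h01 hK eps eps0.
pose e1 := Num.min (eps / 3) (1 / 2).
have e1_gt0 : 0 < e1 by rewrite lt_min !divr_gt0.
have e1_le : e1 <= eps / 3 by rewrite ge_min lexx.
have e1_le2 : e1 <= 1 / 2 by rewrite ge_min lexx orbT.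
have [K1 K1_ge1 [tail1 tail2 tail3]] := normal_tail e1_gt0.
pose th := bump (- K1) K1 (1 : R).
have cth : continuous th by exact: continuous_bump.
have th01 t : 0 <= th t <= 1 by exact: bump_itv.
have gth : 1 - e1 <= gauss_mean th <= 1.
  apply/andP; split.
    apply: le_trans tail2 _; apply: gauss_mean_ge => // t.
    rewrite /= in_itv /= => /andP[t1 t2].
    by apply: bump1 => //; rewrite ltW.
  exact: gauss_mean_le1.
have gth0 : gauss_mean th != 0 by rewrite gt_eqF //; move/andP: gth => [H _]; lra.
pose c := gauss_mean h / gauss_mean th.
have gh : 0 <= gauss_mean h <= 1.
  apply/andP; split.
    apply: Rintegral_ge0 => t _; rewrite mulr_ge0 ?normal_pdf_ge0 //.
    by have /andP[] := h01 t.
  exact: gauss_mean_le1.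
have c02 : 0 <= c <= 2.
  case/andP: gth => g1 g2; case/andP: gh => h0 h1.
  rewrite /c divr_ge0 /= ?ler_pdivrMr; lra.
pose h' t := h t - c * th t.
have ch' : continuous h'.
  by move=> t; apply: cvgB; [exact: ch|apply: cvgMr; exact: cth].
have hM' t : `|h' t| <= 3.
  have /andP[a0 a1] := h01 t; have /andP[b0 b1] := th01 t; case/andP: c02 => c0 c2.
  by rewrite /h' ler_norml; nra.
have sh' : supported_in (`|K| + (`|- K1| + `|K1| + 1)) h'.
  move=> t Ht; rewrite /h' (hK t) /th ?bump_supported ?mulr0 ?subr0 //.
    by apply: le_trans Ht; rewrite lerDr.
  apply: le_trans Ht; apply: le_trans (ler_norm K) _; rewrite lerDl.
  by rewrite !addr_ge0.
have gh' : gauss_mean h' = 0.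
  by rewrite (gauss_meanB _ ch cth (norm_le1 h01) (norm_le1 th01)) /c divfK // subrr.
have [delta d0 Hd] := stein_clt ch' hM' sh' gh' e1_gt0.
exists delta => // I D p p01 sd0 sdd; have := Hd I D p p01 sd0 sdd.
have -> : expect p (fun A => h' (Z p D A)) =
    expect p (fun A => h (Z p D A)) - c * expect p (fun A => th (Z p D A)).
  rewrite -[c * _]opprK -mulNr -expectZ -[RHS]/(_ - _) opprK.
  by rewrite -expectD; apply: eq_expect => A; rewrite /h' mulNr.
have p01' : 0 <= p <= 1 by case/andP: p01 => *; rewrite !ltW.
have Eth : 1 - e1 <= expect p (fun A => th (Z p D A)) <= 1.
  apply/andP; split; last first.
    rewrite -[leRHS](expect_cst (I := I) p); apply: ler_expect => // A.
    by have /andP[] := th01 (Z p D A).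
  have := prob_itv p01 sd0 K1_ge1 tail3; rewrite (prob_predC p (fun A => _ < _)) => H.
  have : prob p (predC (fun A => K1 < `|Z p D A|)) <= expect p (fun A => th (Z p D A)).
    apply: prob_le_expect => // A; first by have /andP[] := th01 (Z p D A).
    by rewrite /= -leNgt ler_norml => ?; rewrite /th bump1.
  lra.
have -> : gauss_mean h = c * gauss_mean th by rewrite /c divfK.
move: (expect p _) (expect p _) Eth => x y; move: (gauss_mean th) gth => z.
move=> /andP[z1 z2] /andP[y1 y2]; case/andP: c02 => c0 c2.
rewrite !ler_norml => /andP[H1 H2]; apply/andP; split; nra.
Qed.

(** The indicator of ]-oo, x] is caught between bumps ending near [x]. Their left end is put at
    [- K1] to keep the support compact, which costs one tail probability on each side. *)
Lemma binomial_clt x :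
  uniformly (fun eps I p D =>
    `|prob p (fun A => Z p D A <= x) - normal_cdf x| <= eps).
Proof.
move=> eps eps0; pose e1 := eps / 4.
have e1_gt0 : 0 < e1 by rewrite divr_gt0.
have [K1 K1_ge1 [tail1 tail2 tail3]] := normal_tail e1_gt0.
have cb b := @continuous_bump R (- K1) b e1.
have sb b := @bump_supported R e1 e1_gt0 (- K1) b.
have b01 b := @bump_itv R (- K1) b e1.
have [d1 d10 Hd1] := expect_standardized_cvg (cb x) (b01 x) (sb x) e1_gt0.
have [d2 d20 Hd2] :=
  expect_standardized_cvg (cb (x - e1)) (b01 (x - e1)) (sb (x - e1)) e1_gt0.
exists (Num.min d1 d2); first by rewrite lt_min d10.
move=> I D p p01 sd0; rewrite le_min => /andP[sd1 sd2].
have p01' : 0 <= p <= 1 by case/andP: p01 => *; rewrite !ltW.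
have {Hd1 sd1} := Hd1 I D p p01 sd0 sd1; have {Hd2 sd2} := Hd2 I D p p01 sd0 sd2.
rewrite !ler_norml => /andP[L1 _] /andP[_ U2].
have tailp := prob_itv p01 sd0 K1_ge1 tail3.
have up : prob p (fun A => Z p D A <= x) <=
    expect p (fun A => bump (- K1) x e1 (Z p D A)) + prob p (fun A => K1 < `|Z p D A|).
  rewrite [X in _ + X]probE -expectD; apply: prob_le_expect => // A.
    by rewrite addr_ge0 //; have /andP[] := b01 x (Z p D A).
  move=> ZA; case: ltP => /= [_|]; last first.
    by rewrite ler_norml => /andP[Z1 Z2]; rewrite bump1 ?addr0 // Z1.
  by rewrite lerDr; have /andP[] := b01 x (Z p D A).
have low : expect p (fun A => bump (- K1) (x - e1) e1 (Z p D A)) <=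
    prob p (fun A => Z p D A <= x).
  rewrite probE; apply: ler_expect => // A; case: (lerP (Z p D A) x) => /= ZA.
    by have /andP[] := b01 (x - e1) (Z p D A).
  by rewrite bump0r // subrK ltW.
have upg : gauss_mean (bump (- K1) x e1) <= normal_cdf (x + e1).
  apply: gauss_mean_le => [|//|//|t /= /negP]; first exact: measurable_itv.
  by rewrite in_itv /= -ltNge => xt; rewrite bump0r // ltW.
have lowg : normal_cdf (x - e1) - normal_cdf (- K1) <= gauss_mean (bump (- K1) (x - e1) e1).
  (* If [x - e1] lies left of [- K1], the left-hand side is at most 0. *)
  have [Kx|xK] := lerP (- K1) (x - e1).
    rewrite -normal_cdfB //; apply: gauss_mean_ge (cb _) (b01 _) _ => // t /=.
    by rewrite in_itv /= => /andP[t1 t2]; rewrite bump1 // ltW.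
  apply: (@le_trans _ _ 0).
    rewrite subr_le0 -subr_ge0 -normal_cdfB; last exact: ltW.
    by apply: fine_ge0; apply: integral_ge0 => t _; rewrite lee_fin normal_pdf_ge0.
  apply: Rintegral_ge0 => t _; rewrite mulr_ge0 ?normal_pdf_ge0 //.
  by have /andP[] := b01 (x - e1) t.
have xe : x <= x + e1 by lra.
have xe' : x - e1 <= x by lra.
have := normal_cdf_le xe; have := normal_cdf_le xe'.
have e4 : eps = 4 * e1 by rewrite /e1; field.
rewrite e4; move=> H1 H2; apply/andP; split; lra.
Qed.

End BinomialLimit.

End GaussMean.

(** * Random graphs as random sets of pairs *)

Section EdgeSets.
Context {n : nat}.
Implicit Types (i k : 'I_n).

Definition vpair := {e : 'I_n * 'I_n | (e.1 < e.2)%N}.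

Implicit Types (A : {set vpair}) (S : {set 'I_n}) (e : vpair).

Definition adj_of A : rel 'I_n := fun i k =>
  [exists e in A, (val e == (i, k)) || (val e == (k, i))].

Lemma adj_of_sym A : symmetric (adj_of A).
Proof. by move=> i k; apply: eq_existsb => e; rewrite orbC. Qed.

Lemma adj_of_irr A : irreflexive (adj_of A).
Proof.
move=> i; apply/negbTE; rewrite negb_exists; apply/forallP => e.
rewrite orbb negb_and; apply/orP; right; apply/eqP => E.
by have := valP e; rewrite E /= ltnn.
Qed.

Definition graph_of A := SGraph (@adj_of_sym A) (@adj_of_irr A).

Definition edges_of (G : sgraph 'I_n) : {set vpair} :=
  [set e : vpair | G (val e).1 (val e).2]%SET.

Lemma adj_of_pair A e : adj_of A (val e).1 (val e).2 = (e \in A).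
Proof.
apply/existsP/idP => [[e' /andP[e'A /orP[|]]]|eA]; last first.
- by exists e; rewrite eA -surjective_pairing eqxx.
- move=> /eqP E; have := valP e'; have := valP e; rewrite E /=.
  by move=> /ltnW H; rewrite ltnNge H.
- by rewrite -surjective_pairing => /eqP/val_inj <-.
Qed.

(** Equality of records, not just of adjacency relations, so that any function of the graph, the
    arbitrary [h0] included, becomes a function of its edge set. *)
Lemma edges_ofK (G : sgraph 'I_n) : graph_of (edges_of G) = G.
Proof.
case: G => a s r.
have E : adj_of (edges_of (SGraph s r)) = a.
  apply/funext => i; apply/funext => k; apply/existsP/idP.
    by move=> [e /andP[+ /orP[/eqP E|/eqP E]]]; rewrite inE /= E //= s.
  move=> aik; have [ik|ki|/val_inj ik] := ltngtP i k.
  - by exists (exist _ (i, k) ik); rewrite inE /= aik eqxx.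
  - by exists (exist _ (k, i) ki); rewrite inE /= s aik eqxx orbT.
  - by rewrite ik r in aik.
rewrite /graph_of; move: (@adj_of_sym _) (@adj_of_irr _); rewrite E => s' r'.
by congr SGraph; exact: Prop_irrelevance.
Qed.

Definition star i : {set vpair} :=
  [set e : vpair | ((val e).1 == i) || ((val e).2 == i)]%SET.

Definition boundary S : {set vpair} :=
  [set e : vpair | ((val e).1 \in S) (+) ((val e).2 \in S)]%SET.

Context {R : realType}.

(** Each edge contributes its two orientations. Degree, volume and cut are all instances. *)
Lemma sum_adj_of A (F : 'I_n -> 'I_n -> R) :
  \sum_i \sum_k (adj_of A i k)%:R * F i k =
  \sum_(e in A) (F (val e).1 (val e).2 + F (val e).2 (val e).1).
Proof.
have half (F' : 'I_n -> 'I_n -> R) :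
    \sum_(p : 'I_n * 'I_n | (p.1 < p.2)%N) (adj_of A p.1 p.2)%:R * F' p.1 p.2 =
    \sum_(e in A) F' (val e).1 (val e).2.
  rewrite (reindex_omap (val : vpair -> _) insub) => [|[i k] ik] /=; last first.
    by rewrite insubT.
  rewrite [RHS]big_mkcond; apply: eq_big => [e|e _].
    by rewrite (valP e) valK /= eqxx.
  by rewrite adj_of_pair; case: (e \in A); rewrite ?mul1r ?mul0r.
rewrite pair_big /= (bigID (fun p : 'I_n * 'I_n => (p.1 < p.2)%N)) /= half big_split /=.
congr (_ + _); rewrite -(half (fun i k => F k i)) (bigID (fun p : 'I_n * 'I_n => p.1 == p.2)) /=.
rewrite big1 => [|[i k] /= /andP[_ /eqP ->]]; last by rewrite adj_of_irr mul0r.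
rewrite add0r (reindex_inj (h := fun p : 'I_n * 'I_n => (p.2, p.1))) /=; last first.
  by move=> [i k] [i' k'] [-> ->].
apply: eq_big => [[i k]|[i k] _] /=; last by rewrite adj_of_sym.
by rewrite -leqNgt [in RHS]ltn_neqAle andbC eq_sym.
Qed.

Lemma card_setI_sum A D : #|A :&: D|%:R = \sum_(e in A) (e \in D)%:R :> R.
Proof.
rewrite -sum1_card natr_sum big_mkcond [RHS]big_mkcond /=.
by apply: eq_bigr => e _; rewrite finset.in_setI; case: (e \in A); case: (e \in D).
Qed.

Lemma degree_graph_of A i : (degree (graph_of A) i)%:R = #|A :&: star i|%:R :> R.
Proof.
rewrite degreeE card_setI_sum.
have -> : \sum_k (graph_of A i k)%:R =
    \sum_i' \sum_k (adj_of A i' k)%:R * (i' == i)%:R :> R.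
  rewrite [RHS](bigD1 i) //= [X in _ + X]big1 ?addr0 => [|i' /negbTE ->]; last first.
    by apply: big1 => k _; rewrite mulr0.
  by apply: eq_bigr => k _; rewrite eqxx mulr1.
rewrite sum_adj_of; apply: eq_bigr => e _; rewrite inE.
case: eqP => [<-|_] /=; last by rewrite add0r.
by case: eqP => [E|_]; rewrite ?addr0 //; have := valP e; rewrite E /= ltnn.
Qed.

Lemma volume_graph_of A : (volume (graph_of A))%:R = 2 * #|A|%:R :> R.
Proof.
rewrite volumeE; transitivity (\sum_i \sum_k (adj_of A i k)%:R * 1 : R).
  by apply: eq_bigr => i _; rewrite degreeE; apply: eq_bigr => k _; rewrite mulr1.
by rewrite (sum_adj_of A (fun _ _ => 1)) sumr_const -[LHS]mulr_natr.
Qed.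

Lemma cut_graph_of A S : cut (graph_of A) S = #|A :&: boundary S|%:R :> R.
Proof.
rewrite /cut sum_adj_of card_setI_sum; apply: eq_bigr => e _; rewrite inE.
by case: (_ \in S); case: (_ \in S); rewrite /= ?addr0 ?add0r.
Qed.

(** The cardinals of [star], of [boundary] and of all pairs are then obtained as degree, cut and
    volume of the complete graph. *)
Let complete i k : adj_of finset.setT i k = (i != k).
Proof.
apply/existsP/idP => [[e /andP[_ /orP[]/eqP E]]|].
- by apply/eqP => ik; have := valP e; rewrite E ik /= ltnn.
- by apply/eqP => ik; have := valP e; rewrite E ik /= ltnn.
move=> ik; have [lt|lt|/val_inj eq] := ltngtP i k.
- by exists (exist _ (i, k) lt); rewrite finset.in_setT /= eqxx.
- by exists (exist _ (k, i) lt); rewrite finset.in_setT /= eqxx orbT.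
- by rewrite eq eqxx in ik.
Qed.

Lemma card_star i : #|star i|%:R = n%:R - 1 :> R.
Proof.
rewrite -[star i]finset.setTI -degree_graph_of degreeE /= (bigD1 i) //=.
rewrite complete eqxx add0r (eq_bigr (fun=> 1)) => [|k ki]; last first.
  by rewrite complete eq_sym ki.
have : \sum_(k : 'I_n) 1 = n%:R :> R by rewrite sumr_const card_ord.
by rewrite (bigD1 i) //= => <-; rewrite addrAC subrr add0r.
Qed.

Lemma card_vpair : 2 * #|[set: vpair]%SET|%:R = n%:R * (n%:R - 1) :> R.
Proof.
rewrite -volume_graph_of volumeE.
under eq_bigr do rewrite degree_graph_of finset.setTI card_star.
by rewrite sumr_const card_ord -[LHS]mulr_natl.
Qed.

Lemma card_boundary S : #|boundary S|%:R = #|S|%:R * (n%:R - #|S|%:R) :> R.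
Proof.
rewrite -[boundary S]finset.setTI -cut_graph_of /cut.
have -> : #|S|%:R = \sum_(i in S) 1 :> R by rewrite sumr_const.
rewrite big_distrl /= [RHS]big_mkcond /=; apply: eq_bigr => i _.
case: (boolP (i \in S)) => iS /=; last by apply: big1 => k _; rewrite mulr0.
have cC : #|S|%:R + #|~: S|%:R = n%:R :> R by rewrite -natrD cardsC card_ord.
rewrite mul1r sumr_const -cC addrAC subrr add0r.
rewrite -sum1_card natr_sum [RHS]big_mkcond /=; apply: eq_bigr => k _.
rewrite complete finset.in_setC; case: (boolP (k \in S)) => kS; first by rewrite mulr0.
by rewrite mulr1; case: eqVneq => // ik; rewrite -ik iS in kS.
Qed.

(* On this event the Cheeger bound gives the Poincare constant
   (4 n p) / (n p / 8) ^ 2 = 256 / (n p). *)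
Definition expanding (p : R) A : bool :=
  [forall S : {set 'I_n}, ((0 < #|S|)%N && (2 * #|S| <= n)%N) ==>
     (n%:R * p / 8 * #|S|%:R <= #|A :&: boundary S|%:R)] &&
  [forall i, #|A :&: star i|%:R <= 4 * (n%:R * p)].

Lemma expanding_hitting_time (p : R) (h0 : sgraph 'I_n -> R) A j :
    (1 < n)%N -> 0 < p -> expanding p A ->
  let c := 2 * #|A|%:R / #|A :&: star j|%:R in
  [/\ (0 < #|A :&: star j|)%N,
      c - 2 <= target_hitting_time_or h0 (graph_of A) j &
      target_hitting_time_or h0 (graph_of A) j <=
        c - 2 + 512 / (n%:R * p) * (4 * (n%:R * p) + c)].
Proof.
move=> n1 p0 /andP[/forallP good1 /forallP good2] c.
have n0 : 0 < n%:R :> R by rewrite ltr0n ltnW.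
have np0 : 0 < n%:R * p by rewrite mulr_gt0.
have al0 : 0 < n%:R * p / 8 by rewrite divr_gt0.
have D0 : 0 < 4 * (n%:R * p) by rewrite mulr_gt0.
have dl i : (degree (graph_of A) i)%:R <= 4 * (n%:R * p).
  by rewrite degree_graph_of good2.
have ex (S : {set 'I_n}) : (0 < #|S|)%N -> (2 * #|S| <= #|'I_n|)%N ->
    n%:R * p / 8 * #|S|%:R <= cut (graph_of A) S :> R.
  by rewrite card_ord cut_graph_of => S0 Sn; have := good1 S; rewrite S0 Sn.
have HP := expansion_poincare al0 D0 dl ex.
have deg0 i : (0 < degree (graph_of A) i)%N.
  by apply: (expansion_degree_gt0 al0 ex); rewrite card_ord.
have K0 : 0 < 4 * (n%:R * p) / (n%:R * p / 8) ^+ 2 by rewrite divr_gt0 ?exprn_gt0.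
have [H HE HH] := mean_target_hitting_time_bounds j K0 deg0 HP dl.
have -> : target_hitting_time_or h0 (graph_of A) j = H.
  by rewrite /target_hitting_time_or (expansion_connected al0 D0 dl ex) HE.
move: HH; rewrite volume_graph_of degree_graph_of -/c.
have -> : 2 * (4 * (n%:R * p) / (n%:R * p / 8) ^+ 2) = 512 / (n%:R * p).
  by field; rewrite !gt_eqF.
move=> /andP[H1 H2]; split => //.
by rewrite -(ltr0n R) -degree_graph_of ltr0n.
Qed.

(** A set of size s <= n / 2 has at least s n / 2 boundary pairs, so the Chernoff bound at level n p
    s / 8 is at most exp (n p s / 8 - n p s / 4) = y ^ s. Summing y ^ |S| over the nonempty sets
    gives (1 + y) ^ n - 1 <= exp (n y) - 1, with no binomial coefficients to estimate. The last term
    accounts for the degrees. *)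
Lemma prob_expanding (p : R) : 0 <= p <= 1 ->
  prob p (predC (expanding p)) <=
    expR (n%:R * expR (- (n%:R * p / 8))) - 1 + n%:R * expR (- (n%:R * p / 8)).
Proof.
move=> p01; have /andP[p0 p1] := p01.
set y := expR (- (n%:R * p / 8)).
have y0 : 0 <= y by exact: expR_ge0.
pose Q1 (S : {set 'I_n}) A : bool := #|A :&: boundary S|%:R <= n%:R * p / 8 * #|S|%:R.
pose Q2 i A : bool := 4 * (n%:R * p) <= #|A :&: star i|%:R.
pose P1 (S : {set 'I_n}) := (0 < #|S|)%N && (2 * #|S| <= n)%N.
have sub : subpred (predC (expanding p)) (predU
    (fun A => [exists S : {set 'I_n}, P1 S && Q1 S A]) (fun A => [exists i, true && Q2 i A])).
  move=> A /=; rewrite /expanding negb_and !negb_forall.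
  move=> /orP[/existsP[S]|/existsP[i]]; rewrite ?negb_imply -ltNge => H; apply/orP.
    left; apply/existsP; exists S; move: H => /andP[PS H]; rewrite /P1 PS /=.
    by rewrite /Q1 ltW.
  by right; apply/existsP; exists i; rewrite /Q2 ltW.
apply: (le_trans (ler_prob p01 sub)); apply: (le_trans (prob_predU p01 _ _)).
apply: lerD.
  apply: (le_trans (prob_has p01 _ _)).
  apply: (@le_trans _ _ (\sum_(S : {set 'I_n} | P1 S) y ^+ #|S|)).
    apply: ler_sum => S /andP[S0 Sn]; apply: (le_trans (chernoff_lower p01 _ _)).
    rewrite -expRM_natr ler_expR card_boundary.
    have Sn' : 2 * #|S|%:R <= n%:R :> R by rewrite -natrM ler_nat.
    have s0 : 0 <= #|S|%:R :> R by exact: ler0n.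
    have ps : 0 <= p * #|S|%:R by rewrite mulr_ge0.
    nra.
  apply: (@le_trans _ _ (\sum_(S : {set 'I_n} | (0 < #|S|)%N) y ^+ #|S|)).
    rewrite big_mkcond [leRHS]big_mkcond; apply: ler_sum => S _.
    rewrite /P1; case: (0 < _)%N => //=; case: ifP => // _.
    by rewrite exprn_ge0.
  rewrite lerBrDr; apply: (@le_trans _ _ ((1 + y) ^+ n)); last first.
    by rewrite expRM_natl lerXn2r ?nnegrE ?expR_ge0 ?addr_ge0 ?expR_ge1Dx.
  have -> : (1 + y) ^+ n = \sum_(S : {set 'I_n}) y ^+ #|S|.
    have -> : (1 + y) ^+ n = \prod_(i < n) (y + 1) by rewrite prodr_const card_ord addrC.
    rewrite bigA_distr /=; apply: eq_bigr => S _.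
    by rewrite -prodr_const [RHS]big_mkcond.
  rewrite [leRHS](bigD1 finset.set0) //= cards0 expr0 addrC lerD2r.
  by rewrite le_eqVlt; apply/orP; left; apply/eqP; apply: eq_bigl => S; rewrite card_gt0.
apply: (le_trans (prob_has p01 _ _)).
apply: (@le_trans _ _ (\sum_(i : 'I_n) y)); last first.
  by rewrite sumr_const card_ord mulr_natl.
apply: ler_sum => i _; apply: (le_trans (chernoff_upper p01 _ _)).
rewrite ler_expR card_star.
have : 0 <= n%:R * p by rewrite mulr_ge0.
nra.
Qed.

End EdgeSets.

(** * Comparison with the degree of the target *)

Section Transfer.
Context {d : measure_display} {T : measurableType d} {R : realType}.
Context (P : probability T R) {n : nat} (G : T -> sgraph 'I_n) (p : R).
Hypothesis hG : erdos_renyi P G p.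

(** Independence is given as a product formula for intersections of edge events, which is exactly
    the inclusion probability [p ^+ #|S|] that determines the law of the edge set. *)
Lemma erdos_renyi_prob (Q : pred (sgraph 'I_n)) :
  P [set w | Q (G w)] = (prob p (fun A : {set vpair} => Q (graph_of A)))%:E.
Proof.
have [mG PG indep] := hG.
have E (e : vpair) : [set w | e \in edges_of (G w)] = edge_event G (val e).
  by apply/seteqP; split => w; rewrite /edge_event /edges_of /= inE.
rewrite -(@random_set_prob _ _ _ P _ (edges_of \o G)).
- by congr (P _); apply/seteqP; split => w /=; rewrite edges_ofK.
- by move=> e; rewrite /= E; apply: mG; exact: valP.
move=> S; have SD : {subset (val @: S : {set _})%SET <=
    [pred e : 'I_n * 'I_n | (e.1 < e.2)%N]}.
  by move=> _ /imsetP[e _ ->]; exact: valP.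
have -> : \bigcap_(e in [set` S]) [set w | e \in (edges_of \o G) w] =
    \bigcap_(e in [set` (val @: S : {set _})%SET]) edge_event G e.
  apply/seteqP; split => w H e /=.
    by move=> /imsetP[e' e'S ->]; rewrite -E; exact: H.
  by move=> eS; have := H (val e); rewrite -E /=; apply; exact: imset_f.
rewrite (indep _ SD) big_imset /=; last by move=> ? ? _ _; exact: val_inj.
rewrite (eq_bigr (fun=> p%:E)) => [|e _]; last by rewrite PG //; exact: valP.
by rewrite prodEFin prodr_const.
Qed.

End Transfer.

Section ErrorBound.
Context {R : realType}.

(* Here [b ^ 2 = n p], [t ^ 2 = 1 - p] and [y ^ 2 = p], so that the scaling
   factor sqrt (p / (n (1 - p))) is [p / (b t)]. *)
Lemma hitting_time_error (K N p t b y sigma dj v H L : R) :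
    1 <= K ->
    0 < p <= 1 -> 0 < N -> 0 < b -> b ^+ 2 = (N + 1) * p ->
    0 < t <= 1 -> 0 < y <= 1 -> y ^+ 2 = p ->
    0 < sigma -> sigma ^+ 2 = N * p * t ^+ 2 ->
    1 <= L -> 4 * L <= b ->
    `|(p * N - dj) / sigma| <= L ->
    `|v - (N + 1) * N * p| <= L * ((N + 1) * y) ->
    v / dj - 2 <= H ->
    H <= v / dj - 2 + K / b ^+ 2 * (4 * b ^+ 2 + v / dj) ->
  `|p / (b * t) * (H - (N + 1)) - (p * N - dj) / sigma| <= (6 + 8 * K) * L ^+ 2 / (b * t).
Proof.
move=> K1 /andP[p0 p1] N0 b0 bE /andP[t0 t1] /andP[y0 y1] yE s0 sE L1 Lb.
set Z := (p * N - dj) / sigma; set c := v / dj.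
move=> ZL vL H1 H2.
have bt0 : 0 < b * t by rewrite mulr_gt0.
have sbt : sigma <= b * t.
  rewrite -ler_sqr ?nnegrE ?(ltW s0) ?(ltW bt0) // sE exprMn bE.
  by rewrite ler_wpM2r ?sqr_ge0 // ler_wpM2r ?(ltW p0) //; lra.
have sb : sigma <= b.
  by apply: le_trans sbt _; rewrite ler_piMr // ltW.
have dE : dj = p * N - sigma * Z by rewrite /Z mulrCA divff ?mulr1 ?gt_eqF //; ring.
have sZ : `|sigma * Z| <= L * b.
  rewrite normrM (gtr0_norm s0) mulrC.
  by apply: ler_pM => //; rewrite ltW.
have pN : p * N = b ^+ 2 - p by rewrite bE; ring.
have b4 : 4 <= b by lra.
(* [4 * L <= b] makes the deviation of [dj] at most [b ^+ 2 / 4], and [4 <= b] covers the term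
   [p]. *)
have dlow : b ^+ 2 / 2 <= dj.
  move: sZ; rewrite ler_norml => /andP[Z1 Z2].
  by rewrite dE pN; nra.
have b20 : 0 < b ^+ 2 by rewrite exprn_gt0.
have d0 : 0 < dj by apply: lt_le_trans dlow; rewrite divr_gt0.
have dinv : dj^-1 <= 2 / b ^+ 2.
  by rewrite -[leRHS]invf_div lef_pV2 ?posrE ?divr_gt0.
have dinv0 : 0 < dj^-1 by rewrite invr_gt0.
(* This is sqrt (N / (N + 1)): the degree is a sum over N pairs, while the scaling uses N + 1
   vertices. *)
pose w := sigma / (b * t).
have w1 : w <= 1 by rewrite /w ler_pdivrMr // mul1r.
have w0 : N / (N + 1) <= w.
  have -> : N / (N + 1) = w ^+ 2.
    rewrite /w expr_div_n sE exprMn bE; field.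
    by rewrite !gt_eqF //; lra.
  rewrite expr2 ler_piMr // /w divr_ge0 // ltW //.
have bw : b ^+ 2 * w <= b ^+ 2 by rewrite ler_piMr // ltW.
have bw' : b ^+ 2 - p <= b ^+ 2 * w.
  rewrite -pN; apply: le_trans (ler_wpM2l (ltW b20) w0).
  by rewrite bE le_eqVlt; apply/orP; left; apply/eqP; field; rewrite gt_eqF //; lra.
set k := (b * t)^-1.
have k0 : 0 < k by rewrite invr_gt0.
have bk : b^-1 <= k.
  by rewrite /k lef_pV2 ?posrE // ler_piMr // ltW.
(* Three errors: the fluctuation of the volume, the linearisation of the inverse degree around its
   mean, and the distance from [H] to [c = v / dj]. *)
have decomp : p / (b * t) * (H - (N + 1)) - Z =
    p * k * ((v - (N + 1) * N * p) * dj^-1) + (b ^+ 2 * w - dj) * dj^-1 * Z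
    + p * k * (H - c).
  have bwE : b ^+ 2 * w = (N + 1) * p * sigma * k by rewrite bE /w /k; ring.
  have sZE : sigma * Z = p * N - dj by rewrite dE; ring.
  have -> : (b ^+ 2 * w - dj) * dj^-1 * Z = (N + 1) * p * k * (sigma * Z) * dj^-1 - Z.
    by rewrite bwE; clearbody Z k; field; rewrite gt_eqF.
  rewrite sZE -/k; clearbody Z k; rewrite /c; field; rewrite gt_eqF //.
rewrite decomp.
have T1 : `|p * k * ((v - (N + 1) * N * p) * dj^-1)| <= 2 * L * k.
  rewrite normrM (gtr0_norm (mulr_gt0 p0 k0)) normrM (gtr0_norm dinv0).
  have : `|v - (N + 1) * N * p| * dj^-1 <= L * ((N + 1) * y) * (2 / b ^+ 2).
    by apply: ler_pM => //; rewrite ltW.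
  move=> /(ler_wpM2l (ltW (mulr_gt0 p0 k0))) /le_trans; apply.
  have -> : p * k * (L * ((N + 1) * y) * (2 / b ^+ 2)) = 2 * L * k * y.
    by rewrite bE; field; rewrite !gt_eqF //; lra.
  by rewrite ler_piMr // !mulr_ge0 ?ltW //; lra.
have T2 : `|(b ^+ 2 * w - dj) * dj^-1 * Z| <= 4 * L ^+ 2 * k.
  have A1 : `|b ^+ 2 * w - dj| <= 1 + L * b.
    move: sZ; rewrite !ler_norml dE pN => /andP[Z1 Z2]; apply/andP; split; nra.
  have A2 : `|(b ^+ 2 * w - dj) * dj^-1| <= (1 + L * b) * (2 / b ^+ 2).
    by rewrite normrM (gtr0_norm dinv0); apply: ler_pM => //; rewrite ltW.
  rewrite normrM; apply: (@le_trans _ _ ((1 + L * b) * (2 / b ^+ 2) * L)).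
    by apply: ler_pM.
  apply: (@le_trans _ _ (4 * L ^+ 2 * b^-1)); last first.
    by rewrite ler_wpM2l // mulr_ge0 ?sqr_ge0.
  have -> : 4 * L ^+ 2 * b^-1 = (2 * L * b) * (2 / b ^+ 2) * L.
    by field; rewrite gt_eqF.
  rewrite ler_wpM2r //; first lra.
  by rewrite ler_wpM2r ?divr_ge0 ?ltW //; nra.
have cle : c <= 2 * (N + 1) + 2 * L * (N + 1) / b ^+ 2.
  have vle : v <= (N + 1) * b ^+ 2 + L * (N + 1).
    move: vL; rewrite ler_norml => /andP[_ v2].
    have : L * ((N + 1) * y) <= L * (N + 1).
      by rewrite ler_wpM2l ?ler_piMr //; lra.
    have : (N + 1) * N * p <= (N + 1) * b ^+ 2.
      by rewrite -mulrA ler_wpM2l ?bE //; nra.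
    lra.
  have vle0 : 0 <= (N + 1) * b ^+ 2 + L * (N + 1).
    by rewrite addr_ge0 // mulr_ge0 ?ltW //; lra.
  apply: (@le_trans _ _ (((N + 1) * b ^+ 2 + L * (N + 1)) * (2 / b ^+ 2))).
    apply: (@le_trans _ _ (((N + 1) * b ^+ 2 + L * (N + 1)) * dj^-1)).
      by rewrite /c ler_wpM2r // ltW.
    by rewrite ler_wpM2l.
  by rewrite le_eqVlt; apply/orP; left; apply/eqP; field; rewrite gt_eqF.
have T3 : `|p * k * (H - c)| <= 8 * K * L * k.
  have Hc : p * (H - c) <= 8 * K * L.
    have K0 : 0 <= K / b ^+ 2 by rewrite divr_ge0 ?(ltW b20) ?(le_trans ler01).
    have E : K / b ^+ 2 * (4 * b ^+ 2 + (2 * (N + 1) + 2 * L * (N + 1) / b ^+ 2)) =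
        4 * K + (2 * K + 2 * K * L / b ^+ 2) / p.
      by rewrite bE; field; rewrite !gt_eqF //; lra.
    have : K / b ^+ 2 * (4 * b ^+ 2 + c) <= 4 * K + (2 * K + 2 * K * L / b ^+ 2) / p.
      by rewrite -E; apply: (ler_wpM2l K0); rewrite lerD2l.
    have Lb2 : L / b ^+ 2 <= L.
      have bb : 1 <= b ^+ 2 by rewrite exprn_ege1 //; lra.
      by rewrite ler_pdivrMr // ler_peMr // ltW // (lt_le_trans ltr01).
    have KLb2 : 2 * K * (L / b ^+ 2) <= 2 * K * L.
      by rewrite ler_wpM2l // mulr_ge0 // (le_trans ler01).
    have Kp : K * p <= K by rewrite ler_piMr // (le_trans ler01).
    have KL : K <= K * L by rewrite ler_peMr // (le_trans ler01).
    move=> Hle.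
    have : H - c <= 4 * K + (2 * K + 2 * K * L / b ^+ 2) / p by move: H2 Hle; lra.
    move=> /(ler_wpM2l (ltW p0)).
    have -> : p * (4 * K + (2 * K + 2 * K * L / b ^+ 2) / p) =
      4 * (K * p) + 2 * K + 2 * K * (L / b ^+ 2) by field; rewrite !gt_eqF.
    by move: Kp KL KLb2; lra.
  have Hc' : - (8 * K * L) <= p * (H - c).
    have KL : 1 <= K * L by rewrite mulr_ege1.
    have : p * -2 <= p * (H - c) by rewrite ler_wpM2l ?(ltW p0) //; lra.
    lra.
  rewrite mulrAC normrM (gtr0_norm k0) ler_wpM2r ?(ltW k0) // ler_norml.
  by rewrite Hc Hc'.
apply: (@le_trans _ _ (2 * L * k + 4 * L ^+ 2 * k + 8 * K * L * k)).
  apply: le_trans (ler_normD _ _) _; apply: lerD => //.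
  by apply: le_trans (ler_normD _ _) _; exact: lerD.
have -> : 2 * L * k + 4 * L ^+ 2 * k + 8 * K * L * k = (2 * L + 4 * L ^+ 2 + 8 * K * L) * k.
  by ring.
apply: ler_wpM2r; first exact: ltW.
have LL : L <= L ^+ 2 by rewrite expr2 ler_peMr // (le_trans ler01).
have KLL : K * L <= K * L ^+ 2 by rewrite ler_wpM2l // (le_trans ler01).
by move: LL KLL; lra.
Qed.

End ErrorBound.

Section Comparison.
Context {R : realType}.

(** The deterministic estimate applies outside three events: failure of expansion, a degree
    deviation beyond [L], and a volume deviation beyond [L * (m.+1%:R * y)]. Chebyshev bounds the
    last two by 1 / L ^ 2 and 2 / L ^ 2, the variance of the volume being 2 p (1 - p) n (n - 1). *)
Lemma hitting_time_close : exists2 C : R, 0 < C &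
  forall (m : nat) (p : R) (j : 'I_m.+1) (h0 : sgraph 'I_m.+1 -> R) (L eta : R),
    (0 < m)%N -> 0 < p < 1 -> 1 <= L -> 4 * L <= Num.sqrt (m.+1%:R * p) ->
    C * L ^+ 2 / (Num.sqrt (m.+1%:R * p) * Num.sqrt (1 - p)) <= eta ->
  prob p (fun A : {set vpair} => eta < `|Num.sqrt (p / (m.+1%:R * (1 - p))) *
      (target_hitting_time_or h0 (graph_of A) j - m.+1%:R) -
      standardized p (star j) A|) <=
    prob p (predC (@expanding m.+1 R p)) + 3 / L ^+ 2.
Proof.
(* [hitting_time_error] is used with K = 512, twice the Poincare factor 256. *)
exists (6 + 8 * 512) => [|m p j h0 L eta m0 /andP[p0 p1] L1 Lb Leta].
  lra.
have p01 : 0 <= p <= 1 by rewrite !ltW.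
have q0 : 0 < 1 - p by rewrite subr_gt0.
have n0 : 0 < m.+1%:R :> R by rewrite ltr0n.
have mR0 : 0 < m%:R :> R by rewrite ltr0n.
set b := Num.sqrt (m.+1%:R * p) in Lb Leta *.
set t := Num.sqrt (1 - p) in Leta *.
have b0 : 0 < b by rewrite sqrtr_gt0 mulr_gt0.
have t0 : 0 < t by rewrite sqrtr_gt0.
have b2 : b ^+ 2 = m.+1%:R * p by rewrite sqr_sqrtr // mulr_ge0 // ltW.
have t2 : t ^+ 2 = 1 - p by rewrite sqr_sqrtr // ltW.
have L0 : 0 < L by exact: lt_le_trans L1.
pose y := Num.sqrt p.
have y0 : 0 < y by rewrite sqrtr_gt0.
have y2 : y ^+ 2 = p by rewrite sqr_sqrtr // ltW.
have starE : #|star j|%:R = m%:R :> R by rewrite card_star -natr1 addrK.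
have sdE : binomial_sd p (star j) ^+ 2 = m%:R * p * (1 - p).
  by rewrite sqr_sqrtr starE // !mulr_ge0 // ltW.
have sd0 : 0 < binomial_sd p (star j).
  by rewrite sqrtr_gt0 starE !mulr_gt0.
have scaleE : Num.sqrt (p / (m.+1%:R * (1 - p))) = p / (b * t).
  rewrite -[RHS]gtr0_norm ?divr_gt0 ?mulr_gt0 // -sqrtr_sqr; congr Num.sqrt.
  by rewrite expr_div_n exprMn b2 t2; field; rewrite !gt_eqF.
pose Q1 A := L < `|standardized p (star j) A|.
pose Q2 (A : {set @vpair m.+1}) :=
  L * (m.+1%:R * y) < `|\sum_e 2 * ((e \in A)%:R - p)|.
have sub : subpred (fun A : {set vpair} => eta < `|Num.sqrt (p / (m.+1%:R * (1 - p))) *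
      (target_hitting_time_or h0 (graph_of A) j - m.+1%:R) - standardized p (star j) A|)
    (predU (predC (@expanding m.+1 R p)) (predU Q1 Q2)).
  move=> A /=; apply: contraLR; rewrite !negb_or negbK -!leNgt => /andP[exA /andP[q1 q2]].
  apply: le_trans Leta; rewrite scaleE -natr1.
  have [_ H1 H2] := expanding_hitting_time h0 j (m0 : (1 < m.+1)%N) p0 exA.
  rewrite /standardized starE.
  apply: (@hitting_time_error R 512 m%:R p t b y _ _ (2 * #|A|%:R)) => //.
  - by rewrite ler1n.
  - by rewrite p0 ltW.
  - by rewrite natr1.
  - by rewrite t0 /t -[leRHS]sqrtr1 ler_wsqrtr // gerBl ltW.
  - by rewrite y0 /y -[leRHS]sqrtr1 ler_wsqrtr // ltW.
  - by rewrite sdE t2.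
  - by move: q1; rewrite /Q1 /standardized starE.
  - rewrite natr1; apply: le_trans q2; rewrite le_eqVlt; apply/orP; left; apply/eqP.
    congr `|_|; rewrite -mulr_sumr sumrB sumr_const.
    have -> : \sum_(e : vpair) (e \in A)%:R = #|A|%:R :> R.
      rewrite -sum1_card natr_sum [RHS]big_mkcond /=; apply: eq_bigr => e _.
      by case: (e \in A).
    have := @card_vpair m.+1 R; rewrite -[in X in X - _]natr1 addrK cardsT => E.
    by rewrite mulrBr -[p *+ _]mulr_natr [p * _]mulrC mulrA E.
  - by move: H2; rewrite b2.
apply: (le_trans (ler_prob p01 sub)); apply: (le_trans (prob_predU p01 _ _)).
rewrite lerD2l; apply: (le_trans (prob_predU p01 _ _)).
have P1 : prob p Q1 <= L ^- 2 by apply: standardized_chebyshev => //; rewrite p0.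
have P2 : prob p Q2 <= 2 / L ^+ 2.
  have Ln0 : 0 < L * (m.+1%:R * y) by rewrite !mulr_gt0.
  apply: (le_trans (chebyshev_weight p01 (fun=> 2) Ln0)).
  rewrite sumr_const -[2 ^+ 2 *+ _]mulr_natr.
  have := @card_vpair m.+1 R; rewrite cardsT => E.
  have -> : p * (1 - p) * (2 ^+ 2 * #|{: @vpair m.+1}|%:R) =
      2 * p * (1 - p) * (m.+1%:R * (m.+1%:R - 1)) by rewrite -E; ring.
  rewrite !exprMn y2 ler_pdivrMr ?mulr_gt0 ?exprn_gt0 //.
  have -> : 2 / L ^+ 2 * (L ^+ 2 * (m.+1%:R ^+ 2 * p)) = 2 * p * (m.+1%:R ^+ 2).
    by field; rewrite gt_eqF.
  rewrite -mulrA ler_wpM2l ?mulr_ge0 // ?(ltW p0) // expr2.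
  have : 0 <= p * (m.+1%:R * (m.+1%:R - 1)).
    by rewrite -[m.+1%:R]natr1 addrK !mulr_ge0 // ?ltW // natr1.
  nra.
have -> : 3 / L ^+ 2 = L ^- 2 + 2 / L ^+ 2 by field; rewrite gt_eqF.
exact: lerD.
Qed.

End Comparison.

(** * Consequences of the density condition *)

Section Asymptotics.
Context {R : realType} (p : nat -> R) (xi : R).
Hypothesis hp : forall n, 0 < p n < 1.
Hypothesis hxi : 1 < xi.
Hypothesis hlog : (ln n%:R `^ (6 * xi)) / (n%:R * p n) @[n --> \oo] --> (0 : R).

(** Once [ln n >= 1], the numerator of [hlog] dominates ln n, hence n p >= 16 ln n eventually. The
    16 is chosen so that exp (- n p / 8) <= n ^ -2. *)
Lemma mean_degree_large (B : R) : \forall n \near \oo,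
  B <= n%:R * p n /\ n%:R * expR (- (n%:R * p n / 8)) <= n%:R^-1.
Proof.
have e0 : 0 < 16^-1 :> R by rewrite invr_gt0.
move/cvgrPdist_le/(_ _ e0) : hlog => hl.
near=> n.
have n_gt0 : 0 < n%:R :> R by rewrite ltr0n; near: n; exact: nbhs_infty_gt.
have ln_ge : Num.max 1 B <= ln (n%:R : R).
  rewrite -[leLHS]expRK ler_ln ?posrE ?expR_gt0 //.
  by near: n; exact: nbhs_infty_ger.
have /andP[pn0 pn1] := hp n.
have np0 : 0 < n%:R * p n by rewrite mulr_gt0.
have ln1 : 1 <= ln (n%:R : R) by apply: le_trans ln_ge; rewrite le_max lexx.
have lnp : 16 * ln (n%:R : R) <= n%:R * p n.
  have : ln n%:R <= ln n%:R `^ (6 * xi) :> R.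
    rewrite -[leLHS]powRr1; last by apply: le_trans ln1.
    by apply: ler_powR => //; have := hxi; lra.
  have : `|0 - ln n%:R `^ (6 * xi) / (n%:R * p n)| <= 16^-1 :> R by near: n; exact: hl.
  rewrite sub0r normrN ger0_norm ?divr_ge0 ?powR_ge0 ?(ltW np0) //.
  rewrite ler_pdivrMr //; lra.
split.
  have : B <= ln (n%:R : R) by apply: le_trans ln_ge; rewrite le_max lexx orbT.
  lra.
apply: (@le_trans _ _ (n%:R * expR (- (2 * ln n%:R)))).
  by rewrite ler_wpM2l ?(ltW n_gt0) // ler_expR; lra.
rewrite expRN expRM_natl lnK ?posrE // expr2 invfM mulrA divff ?gt_eqF //.
by rewrite mul1r.
Unshelve. all: by end_near.
Qed.

Lemma prob_expanding_cvg (eps : R) : 0 < eps ->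
  \forall n \near \oo, prob (p n) (predC (@expanding n R (p n))) <= eps.
Proof.
move=> eps0; near=> n.
have [_ Hn] : 0 <= n%:R * p n /\ n%:R * expR (- (n%:R * p n / 8)) <= n%:R^-1.
  by near: n; exact: mean_degree_large.
have p01 : 0 <= p n <= 1 by have /andP[p0 p1] := hp n; rewrite !ltW.
apply: (le_trans (prob_expanding p01)).
set u := n%:R * _ in Hn *.
(* As u <= 1 / n, the bound 2 gives u <= 1 / 2, where exp u <= 1 / (1 - u) <= 1 + 2 u; then exp u -
   1 + u <= 3 u, and 3 / eps makes this at most [eps]. *)
have nbig : Num.max 2 (3 / eps) <= n%:R by near: n; exact: nbhs_infty_ger.
have n2 : 2 <= n%:R :> R by apply: le_trans nbig; rewrite le_max lexx.
have n3 : 3 / eps <= n%:R by apply: le_trans nbig; rewrite le_max lexx orbT.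
have n0 : 0 < n%:R :> R by lra.
have un : u * n%:R <= 1.
  by have := ler_wpM2r (ltW n0) Hn; rewrite mulVf ?gt_eqF.
have u0 : 0 <= u by rewrite mulr_ge0 ?expR_ge0.
have u_half : u <= 1 / 2 by nra.
have eu : expR u <= 1 + 2 * u.
  have := expR_ge1Dx (- u); rewrite expRN => H.
  have eu0 := expR_gt0 u.
  have : (1 - u) * expR u <= 1.
    by have := ler_wpM2r (ltW eu0) H; rewrite mulVf ?gt_eqF.
  nra.
have : 3 * u <= eps.
  have n3' : 3 <= n%:R * eps by rewrite -ler_pdivrMr.
  have := ler_wpM2l u0 n3'; have := ler_wpM2l (ltW eps0) un; lra.
lra.
Unshelve. all: by end_near.
Qed.

End Asymptotics.

(* Everything is indexed by the number n of vertices; since a graph on 0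
   vertices has no target, the conclusion is read along n = m.+1, m --> oo. *)
Theorem theorem1p1 (R : realType) (p : nat -> R) (xi pbar : R)
    (d : nat -> measure_display) (T : forall n, measurableType (d n))
    (P : forall n, probability (T n) R)
    (G : forall n, T n -> sgraph 'I_n)
    (j : forall m, 'I_m.+1)
    (h0 : forall n, sgraph 'I_n -> R)
    (hp : forall n, 0 < p n < 1)
    (hxi : 1 < xi)
    (hlog : (ln n%:R `^ (6 * xi)) / (n%:R * p n) @[n --> \oo] --> (0 : R))
    (hpbar : 0 < pbar < 1)
    (hppbar : forall n, p n <= pbar)
    (hG : forall n, erdos_renyi (P n) (G n) (p n)) :
  cvg_in_distribution (fun m => P m.+1)
    (fun m w =>
       Num.sqrt (p m.+1 / (m.+1%:R * (1 - p m.+1))) *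
       (target_hitting_time_or (h0 m.+1) (G m.+1 w) (j m) - m.+1%:R))
    (normal_prob 0 1).

Proof.
move=> x _.
pose X m (g : sgraph 'I_m.+1) := Num.sqrt (p m.+1 / (m.+1%:R * (1 - p m.+1))) *
  (target_hitting_time_or (h0 m.+1) g (j m) - m.+1%:R).
pose F m := prob (p m.+1) (fun A : {set vpair} => X m (graph_of A) <= x).
have PE m : P m.+1 [set w | X m (G m.+1 w) <= x] = (F m)%:E.
  exact: (erdos_renyi_prob (hG m.+1) (fun g => X m g <= x)).
have NE : (normal_cdf x)%:E = normal_prob 0 1 (`]-oo, x]%classic : set (measurableTypeR R)).
  by rewrite /normal_cdf fineK // fin_num_measure.
suff FE : (F m)%:E @[m --> \oo] --> (normal_cdf x)%:E.
  rewrite (_ : (fun m => _) = (fun m => (F m)%:E)); last exact/funext.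
  by rewrite NE in FE; exact: FE.
apply: cvg_EFin; first exact: nearW.
apply/cvgrPdist_le => eps eps0 /=.
(* [L] is such that 3 / L ^ 2 <= eps / 8. With eps / 8 for failure of expansion, [eta] for the
   central limit theorem and [eta] for shifting [x], the total stays below [eps]. *)
pose eta := eps / 4; pose L := 1 + 24 / eps.
have eta0 : 0 < eta by rewrite divr_gt0.
have L1 : 1 <= L by rewrite lerDl divr_ge0 // ltW.
have L0 : 0 < L by exact: lt_le_trans L1.
have LE : 3 / L ^+ 2 <= eps / 8.
  rewrite ler_pdivrMr ?exprn_gt0 //.
  have : 24 <= eps * L.
    have -> : eps * L = eps + 24 by rewrite /L; field; rewrite gt_eqF.
    by rewrite lerDr ltW.
  have : eps * L <= eps * L ^+ 2.
    by apply: ler_wpM2l; [exact: ltW|rewrite expr2 ler_peMr // ltW].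
  lra.
have [d1 d10 Hd1] := binomial_clt (x + eta) eta0.
have [d2 d20 Hd2] := binomial_clt (x - eta) eta0.
have [C C0 close] := @hitting_time_close R.
case/andP: hpbar => pb0 pb1.
pose t0 := Num.sqrt (1 - pbar).
have t00 : 0 < t0 by rewrite sqrtr_gt0 subr_gt0.
(* A lower bound to impose on sqrt (n p). Its terms serve, in order, the condition [4 * L <= b], the
   comparison error, and the thresholds [d1] and [d2] on the inverse standard deviation; [t0] bounds
   sqrt (1 - p) from below. *)
pose B := 4 * L + C * L ^+ 2 / (eta * t0) + 2 / (d1 * t0) + 2 / (d2 * t0).
have B1 : 0 <= C * L ^+ 2 / (eta * t0).
  by rewrite divr_ge0 // mulr_ge0 ?sqr_ge0 // ltW.
have B2 : 0 <= 2 / (d1 * t0) by rewrite divr_ge0 ?mulr_ge0 // ltW.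
have B3 : 0 <= 2 / (d2 * t0) by rewrite divr_ge0 ?mulr_ge0 // ltW.
have e8 : 0 < eps / 8 by rewrite divr_gt0.
have [N1 _ HN1] := mean_degree_large hp hxi hlog (B ^+ 2).
have [N2 _ HN2] := prob_expanding_cvg hp hxi hlog e8.
exists (maxn 1 (maxn N1 N2)) => // m /=; rewrite !geq_max => /and3P[m0 mN1 mN2].
have [HB _] := HN1 m.+1 (leqW mN1); have {HN2} Hexp := HN2 m.+1 (leqW mN2).
have /andP[p0 p1] := hp m.+1; have p01 : 0 <= p m.+1 <= 1 by rewrite !ltW.
set b := Num.sqrt (m.+1%:R * p m.+1); set t := Num.sqrt (1 - p m.+1).
have tt : t0 <= t by rewrite ler_wsqrtr // lerD2l lerN2.
have t_gt0 : 0 < t by exact: lt_le_trans tt.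
have n0 : 0 < m.+1%:R :> R by rewrite ltr0n.
have Bb : B <= b.
  rewrite -[leLHS]ger0_norm; last by rewrite !addr_ge0 // mulr_ge0 // ltW.
  by rewrite -sqrtr_sqr ler_wsqrtr.
have b2 : b ^+ 2 = m.+1%:R * p m.+1 by rewrite sqr_sqrtr // mulr_ge0 // ltW.
have t2 : t ^+ 2 = 1 - p m.+1 by rewrite sqr_sqrtr // subr_ge0 ltW.
have Lb : 4 * L <= b by apply: le_trans Bb; rewrite /B; lra.
have b0 : 0 < b by apply: lt_le_trans Lb; rewrite mulr_gt0.
have bt (c del : R) : 0 < del -> c / (del * t0) <= B -> 0 <= c -> c / (b * t) <= del.
  move=> del0 cB c0; rewrite ler_pdivrMr ?mulr_gt0 //.
  move: (le_trans cB Bb); rewrite ler_pdivrMr ?mulr_gt0 // => H.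
  apply: le_trans H _; rewrite mulrCA ler_wpM2l ?(ltW del0) //.
  by rewrite ler_wpM2l ?(ltW b0).
have star2 : #|star (j m)|%:R = m%:R :> R by rewrite card_star -[m.+1%:R]natr1 addrK.
have sd0 : 0 < binomial_sd (p m.+1) (star (j m)).
  by rewrite sqrtr_gt0 star2 !mulr_gt0 ?subr_gt0 // ltr0n.
(* The factor 2 absorbs the passage from m pairs to m + 1 vertices. *)
have sdbt : (binomial_sd (p m.+1) (star (j m)))^-1 <= 2 / (b * t).
  rewrite -[leRHS]invrK invf_div lef_pV2 ?posrE ?divr_gt0 ?mulr_gt0 //.
  rewrite -[leLHS]gtr0_norm ?divr_gt0 ?mulr_gt0 // -sqrtr_sqr ler_wsqrtr //.
  rewrite expr_div_n exprMn b2 t2 star2.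
  have m1 : 1 <= m%:R :> R by rewrite ler1n.
  have -> : m.+1%:R = m%:R + 1 :> R by rewrite natr1.
  have : 0 <= p m.+1 * (1 - p m.+1) by rewrite mulr_ge0 ?subr_ge0 // ltW.
  move: (p m.+1) (m%:R : R) m1 => a c c1; nra.
have sd1 : (binomial_sd (p m.+1) (star (j m)))^-1 <= d1.
  by apply: (le_trans sdbt); apply: bt => //; rewrite /B; have := L0; lra.
have sd2 : (binomial_sd (p m.+1) (star (j m)))^-1 <= d2.
  by apply: (le_trans sdbt); apply: bt => //; rewrite /B; have := L0; lra.
have {}Hd1 := Hd1 _ _ _ (hp m.+1) sd0 sd1.
have {}Hd2 := Hd2 _ _ _ (hp m.+1) sd0 sd2.
have err : C * L ^+ 2 / (b * t) <= eta.
  by apply: bt => //; [rewrite /B; have := L0; lra|rewrite mulr_ge0 ?sqr_ge0 // ltW].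
have {}close := close _ _ (j m) (h0 m.+1) _ _ m0 (hp m.+1) L1 Lb err.
set Z := standardized (p m.+1) (star (j m)) in Hd1 Hd2 close.
set far := fun A => eta < _ in close.
(* Outside [far] the rescaled hitting time and [Z] differ by at most [eta], so the distribution
   function of one is squeezed between shifts by [eta] of that of the other. *)
have up : F m <= prob (p m.+1) (fun A => Z A <= x + eta) + prob (p m.+1) far.
  apply: le_trans (prob_predU p01 _ _); apply: ler_prob => // A /= XA.
  apply/orP; have [|] := boolP (far A); first by right.
  rewrite /far -leNgt -/(X m (graph_of A)) ler_norml => /andP[c1 c2].
  by left; lra.
have low : prob (p m.+1) (fun A => Z A <= x - eta) <= F m + prob (p m.+1) far.
  apply: le_trans (prob_predU p01 _ _); apply: ler_prob => // A /= ZA.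
  apply/orP; have [|] := boolP (far A); first by right.
  rewrite /far -leNgt -/(X m (graph_of A)) ler_norml => /andP[c1 c2].
  by left; lra.
have xe : x <= x + eta by lra.
have xe' : x - eta <= x by lra.
have := normal_cdf_le xe; have := normal_cdf_le xe'.
move: Hd1 Hd2; rewrite !ler_norml /eta => /andP[a1 a2] /andP[a3 a4] a5 a6.
by apply/andP; split; rewrite /eta in up low close a1 a2 a3 a4 *; lra.
Qed.
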